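(* An almost contact metric $5$-manifold $(M^5,g,\xi,\eta,\varphi)$ is a generalized quasi-Sasaki manifold if and only if it is of class $\mathcal W_3\oplus\mathcal W_4\oplus\mathcal W_5\oplus\mathcal W_7$. Respectively, an almost contact metric $5$-manifold is a quasi-Sasaki manifold if and only if it is of class $\mathcal W_3\oplus\mathcal W_5$.
   Context: An almost contact metric structure on a Riemannian $5$-manifold $(M^5,g)$ is a triple $(\xi,\eta,\varphi)$: a unit vector field $\xi$, its dual $1$-form $\eta$, and an endomorphism $\varphi$ of $TM^5$ with $\varphi(\xi)=0$, $\varphi^2=-\mathrm{Id}+\eta\otimes\xi$, $g(\varphi(X),\varphi(Y))=g(X,Y)-\eta(X)\eta(Y)$. Its fundamental form is $\Phi(X,Y):=g(X,\varphi(Y))$; locally there are oriented orthonormal (''adapted'') frames $(e_1,\dots,e_5)$ with $\Phi=e_1\wedge e_2+e_3\wedge e_4$, $\eta=e_5$ ($TM^5$ is identified with its dual via $g$), and these fix the orientation. $\nabla^g$ is the Levi-Civita connection and $d\alpha=\sum_i e_i\wedge\nabla^g_{e_i}\alpha$, so $d\eta(X,Y)=(\nabla^g_X\eta)(Y)-(\nabla^g_Y\eta)(X)$. The Nijenhuis tensor is $$N(X,Y,Z):=g(X,[\varphi,\varphi](Y,Z))+\eta(X)\,d\eta(Y,Z),$$ $$[\varphi,\varphi](X,Y)=[\varphi(X),\varphi(Y)]+\varphi^2([X,Y])-\varphi([\varphi(X),Y])-\varphi([X,\varphi(Y)]).$$ A quasi-Sasaki manifold is an almost contact metric manifold with $N=0$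 and $d\Phi=0$. A generalized quasi-Sasaki manifold is an almost contact metric $5$-manifold such that (i) $N(X,Y,Z)=0$ and $d\Phi(X,Y,Z)=0$ for all $X,Y,Z$ orthogonal to $\xi$; (ii) $\xi$ is a Killing vector field for $g$. Classes. Identify $\mathfrak{so}(5)$ with $\Lambda^2$. With $\ast$ the Hodge operator, $\Lambda^2=\Lambda^2_1\oplus\Lambda^2_2\oplus\Lambda^2_3\oplus\Lambda^2_4$, where $\Lambda^2_1=\{t\Phi\mid t\in\mathbb R\}$, $\Lambda^2_2=\{\beta\mid\Phi\wedge\beta=0,\ \ast\beta=\eta\wedge\beta\}$, $\Lambda^2_3=\{\beta\mid\ast\beta=-\eta\wedge\beta\}$, $\Lambda^2_4=\{\beta\mid\eta\wedge\beta=0\}$; then $\mathfrak u(2)=\Lambda^2_1\oplus\Lambda^2_3$ and $\mathfrak u(2)^\perp=\Lambda^2_2\oplus\Lambda^2_4$. With $\omega^g_{ij}=g(\nabla^ge_i,e_j)$ for an adapted frame and $\Omega^g=(\omega^g_{ij})$, the intrinsic torsion is $\Gamma(X):=\mathrm{pr}_{\mathfrak u(2)^\perp}(\Omega^g(X))$, a section of $\mathcal W:=\Lambda^1\otimes\mathfrak u(2)^\perp$. Let $\mathcal A:=\Lambda^1\otimes\Lambda^2$, $\mathrm{pr}_{\mathcal W}:\mathcal A\to\mathcal W$, $\alpha\otimes\beta\mapsto\alpha\otimes\mathrm{pr}_{\mathfrak u(2)^\perp}(\beta)$, and $\theta,\vartheta:\Lambda^2\to\mathcal A$, $\theta(\beta)(X,Y,Z):=\ast\beta(X,Y,Z)$,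 $\vartheta(\beta)(X,Y,Z):=3\,\eta(X)\beta(Y,Z)-\ast\beta(X,Y,Z)$. The space $\mathcal W$ splits into ten irreducible $\mathrm U(2)$-modules $\mathcal W_1,\dots,\mathcal W_{10}$, among them $\mathcal W_3=\mathrm{pr}_{\mathcal W}(\theta(\Lambda^2_1))$, $\mathcal W_4=\mathrm{pr}_{\mathcal W}(\theta(\Lambda^2_2))=\theta(\Lambda^2_2)$, $\mathcal W_5=\mathrm{pr}_{\mathcal W}(\theta(\Lambda^2_3))$, $\mathcal W_7=\mathrm{pr}_{\mathcal W}(\vartheta(\Lambda^2_2))=\vartheta(\Lambda^2_2)$. The manifold is of class $\mathcal W_{i_1}\oplus\dots\oplus\mathcal W_{i_j}$ if $\Gamma\in\mathcal W_{i_1}\oplus\dots\oplus\mathcal W_{i_j}$. *)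

(* Defs.v *)
From HB Require Import structures.
From mathcomp Require Import all_boot all_order all_algebra.
From mathcomp Require Import all_classical all_reals all_analysis.

Set Implicit Arguments.
Unset Strict Implicit.
Unset Printing Implicit Defensive.
Import Order.TTheory GRing.Theory Num.Theory.
Import numFieldNormedType.Exports.

Local Open Scope classical_set_scope.
Local Open Scope ring_scope.

Section Smooth.
Context {R : realType} {W : normedModType R}.

Fixpoint Ck (k : nat) (U : set 'rV[R]_5) (f : 'rV[R]_5 -> W) : Prop :=
  match k with
  | 0%N => forall x, U x -> {for x, continuous f}
  | k'.+1 => (forall x, U x -> differentiable f x) /\
             (forall v, Ck k' U (fun x => 'D_v f x))
  end.

(* Only used for open [U]. *)
Definition smooth_on (U : set 'rV[R]_5) (f : 'rV[R]_5 -> W) : Prop :=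
  forall k, Ck k U f.

End Smooth.

(* A (not necessarily maximal) smooth atlas on [M]. The functions [chart i] and
   [chart_inv i] are total, but only their values on [chart_dom i] and on its
   image are meaningful. *)
Record smooth_manifold5 (R : realType) (M : topologicalType) := SmoothManifold5 {
  chart_index : Type;
  chart_dom : chart_index -> set M;
  chart : chart_index -> M -> 'rV[R]_5;
  chart_inv : chart_index -> 'rV[R]_5 -> M;
  manifold_hausdorff : hausdorff_space M;
  manifold_second_countable : @second_countable M;
  chart_dom_open : forall i, open (chart_dom i);
  chart_dom_cover : forall p, exists i, chart_dom i p;
  chart_img_open : forall i, open (chart i @` chart_dom i);
  chartK : forall i p, chart_dom i p -> chart_inv i (chart i p) = p;
  chart_continuous : forall i p, chart_dom i p -> {for p, continuous (chart i)};
  chart_inv_continuous : forall i x, (chart i @` chart_dom i) x ->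
    {for x, continuous (chart_inv i)};
  transition_smooth : forall i j,
    smooth_on ((chart i @` chart_dom i) `&` (chart_inv i @^-1` chart_dom j))
              (chart j \o chart_inv i)
}.

Section Charts.
Context {R : realType} {M : topologicalType} (A : smooth_manifold5 R M).
Implicit Types i j : chart_index A.

Definition chart_img i : set 'rV[R]_5 := chart i @` chart_dom i.

Definition transition i j : 'rV[R]_5 -> 'rV[R]_5 := chart j \o chart_inv i.

Definition transition_dom i j : set 'rV[R]_5 :=
  chart_img i `&` (chart_inv i @^-1` chart_dom j).

End Charts.

(* Tangent vectors in a chart are row vectors. A bilinear form with matrix [B]
   is [(u, v) |-> u *m B *m v^T] and an endomorphism with matrix [F] is
   [v |-> v *m F]; the differential of a transition map is [v |-> v *m 'J t x].
   A tensor field on the manifold is the family of its representatives in the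
   charts of the atlas, related by the transition maps. *)
Definition bilin (R : realType) (B : 'M[R]_5) (u v : 'rV[R]_5) : R :=
  (u *m B *m v^T) 0 0.

Definition eta (R : realType) (g : 'rV[R]_5 -> 'M[R]_5)
    (xi : 'rV[R]_5 -> 'rV[R]_5) (x v : 'rV[R]_5) : R :=
  bilin (g x) (xi x) v.

Record riemannian_metric (R : realType) (M : topologicalType)
    (A : smooth_manifold5 R M) := RiemannianMetric {
  metric :> chart_index A -> 'rV[R]_5 -> 'M[R]_5;
  metric_smooth : forall i, smooth_on (chart_img i) (metric i);
  metric_sym : forall i x, chart_img i x -> (metric i x)^T = metric i x;
  metric_posdef : forall i x, chart_img i x ->
    forall v, v != 0 -> 0 < bilin (metric i x) v v;
  metric_transition : forall i j x, transition_dom i j x ->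
    let t := transition i j in
    metric i x = 'J t x *m metric j (t x) *m ('J t x)^T
}.

(* The 1-form eta is not a field of the record: it is the g-dual of xi. *)
Record almost_contact_structure (R : realType) (M : topologicalType)
    (A : smooth_manifold5 R M) (g : riemannian_metric A) :=
  AlmostContactStructure {
  xi : chart_index A -> 'rV[R]_5 -> 'rV[R]_5;
  phi : chart_index A -> 'rV[R]_5 -> 'M[R]_5;
  xi_smooth : forall i, smooth_on (chart_img i) (xi i);
  phi_smooth : forall i, smooth_on (chart_img i) (phi i);
  xi_transition : forall i j x, transition_dom i j x ->
    let t := transition i j in xi j (t x) = xi i x *m 'J t x;
  phi_transition : forall i j x, transition_dom i j x ->
    let t := transition i j in 'J t x *m phi j (t x) = phi i x *m 'J t x;
  xi_unit : forall i x, chart_img i x -> bilin (g i x) (xi i x) (xi i x) = 1;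
  phi_xi : forall i x, chart_img i x -> xi i x *m phi i x = 0;
  phi_sqr : forall i x, chart_img i x -> forall v,
    v *m phi i x *m phi i x = - v + eta (g i) (xi i) x v *: xi i x;
  phi_metric : forall i x, chart_img i x -> forall u v,
    bilin (g i x) (u *m phi i x) (v *m phi i x)
      = bilin (g i x) u v - eta (g i) (xi i) x u * eta (g i) (xi i) x v
}.

Section LocalCalculus.
Context {R : realType}.
Local Notation E := 'rV[R]_5.
(* representatives of g, xi and phi in a chart *)
Variables (g : E -> 'M[R]_5) (xi : E -> E) (phi : E -> 'M[R]_5).
Implicit Types X Y Z : E -> E.

Definition lie_bracket X Y : E -> E :=
  fun x => 'D_(X x) Y x - 'D_(Y x) X x.

(* Christoffel symbol of the second kind, with upper index [c] *)
Definition christoffel (x : E) (a b c : 'I_5) : R :=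
  let dg k i j := 'D_(delta_mx 0 k) (fun y => g y i j) x in
  2^-1 * \sum_(d < 5) invmx (g x) c d * (dg a b d + dg b a d - dg d a b).

Definition levi_civita X Y : E -> E :=
  fun x => 'D_(X x) Y x +
    \row_(c < 5) \sum_(a < 5) \sum_(b < 5)
       christoffel x a b c * X x 0 a * Y x 0 b.

Definition app_phi X : E -> E := fun x => X x *m phi x.

Definition Phi (x : E) (u v : E) : R := bilin (g x) u (v *m phi x).

Definition nabla_eta X Y (x : E) : R :=
  'D_(X x) (fun y => eta g xi y (Y y)) x - eta g xi x (levi_civita X Y x).

Definition d_eta X Y (x : E) : R := nabla_eta X Y x - nabla_eta Y X x.

Definition nabla_Phi X Y Z (x : E) : R :=
  'D_(X x) (fun y => Phi y (Y y) (Z y)) x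
  - Phi x (levi_civita X Y x) (Z x) - Phi x (Y x) (levi_civita X Z x).

(* sum_i e_i /\ nabla_(e_i) Phi evaluated on (X, Y, Z), with the convention
   (a /\ b)(X, Y, Z) = a(X) b(Y, Z) + a(Y) b(Z, X) + a(Z) b(X, Y) *)
Definition d_Phi X Y Z (x : E) : R :=
  nabla_Phi X Y Z x + nabla_Phi Y Z X x + nabla_Phi Z X Y x.

Definition phi_bracket X Y : E -> E := fun x =>
  lie_bracket (app_phi X) (app_phi Y) x
  + lie_bracket X Y x *m phi x *m phi x
  - lie_bracket (app_phi X) Y x *m phi x
  - lie_bracket X (app_phi Y) x *m phi x.

Definition nijenhuis X Y Z (x : E) : R :=
  bilin (g x) (X x) (phi_bracket Y Z x) + eta g xi x (X x) * d_eta Y Z x.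

Definition lie_derivative_metric V X Y (x : E) : R :=
  'D_(V x) (fun y => bilin (g y) (X y) (Y y)) x
  - bilin (g x) (lie_bracket V X x) (Y x)
  - bilin (g x) (X x) (lie_bracket V Y x).

End LocalCalculus.

Section QuasiSasaki.
Context {R : realType} {M : topologicalType} {A : smooth_manifold5 R M}.
Context {g : riemannian_metric A}.
Variable S : almost_contact_structure g.
Local Notation E := 'rV[R]_5.

(* [V] is an open subset of the image of the chart [i]; smooth vector fields
   on such sets represent the local vector fields of the manifold. *)
Definition coordinate_patch (i : chart_index A) (V : set E) : Prop :=
  open V /\ V `<=` chart_img i.

Definition orthogonal_to_xi (i : chart_index A) (V : set E) (X : E -> E) :=
  forall x, V x -> bilin (g i x) (X x) (xi S i x) = 0.

Definition quasi_sasaki : Prop :=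
  forall i V, coordinate_patch i V ->
  forall X Y Z : E -> E, smooth_on V X -> smooth_on V Y -> smooth_on V Z ->
  forall x, V x ->
    nijenhuis (g i) (xi S i) (phi S i) X Y Z x = 0 /\
    d_Phi (g i) (phi S i) X Y Z x = 0.

Definition killing (K : chart_index A -> E -> E) : Prop :=
  forall i V, coordinate_patch i V ->
  forall X Y : E -> E, smooth_on V X -> smooth_on V Y ->
  forall x, V x -> lie_derivative_metric (g i) (K i) X Y x = 0.

Definition generalized_quasi_sasaki : Prop :=
  (forall i V, coordinate_patch i V ->
   forall X Y Z : E -> E, smooth_on V X -> smooth_on V Y -> smooth_on V Z ->
   orthogonal_to_xi i V X -> orthogonal_to_xi i V Y -> orthogonal_to_xi i V Z ->
   forall x, V x ->
     nijenhuis (g i) (xi S i) (phi S i) X Y Z x = 0 /\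
     d_Phi (g i) (phi S i) X Y Z x = 0) /\
  killing (xi S).

End QuasiSasaki.

(* Components with respect to an adapted frame (e_1, ..., e_5), which is
   indexed by 0, ..., 4. A 2-form is the skew-symmetric matrix of its values
   on pairs of frame vectors, an element of Lambda^1 (x) Lambda^2 is a family
   of such matrices indexed by the first slot. *)
Section TorsionModules.
Context {R : realType}.
Local Notation tensor12 := ('I_5 -> 'M[R]_5).
Implicit Types (b c : 'M[R]_5) (i j k l m : 'I_5).

Definition set_sum (V : zmodType) (P Q : set V) : set V :=
  [set v | exists p q, [/\ P p, Q q & v = p + q]].

Definition eta0 i : R := (i == inord 4)%:R.

(* e_1 /\ e_2 + e_3 /\ e_4 *)
Definition Phi0 : 'M[R]_5 :=
  let wedge11 i j := delta_mx i j - delta_mx j i in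
  wedge11 (inord 0) (inord 1) + wedge11 (inord 2) (inord 3).

(* the volume form e_1 /\ ... /\ e_5 *)
Definition vol i j k l m : R :=
  \det (\matrix_(a < 5, c < 5) (nth i [:: i; j; k; l; m] a == c)%:R).

(* the sum over i < j of b i j * vol i j k l m, so that e_1 /\ e_2 is sent to
   e_3 /\ e_4 /\ e_5 *)
Definition hodge b k l m : R :=
  2^-1 * \sum_(i < 5) \sum_(j < 5) b i j * vol i j k l m.

Definition wedge12 (a : 'I_5 -> R) b i j k : R :=
  a i * b j k + a j * b k i + a k * b i j.

Definition wedge22 b c i j k l : R :=
  b i j * c k l - b i k * c j l + b i l * c j k
  + b j k * c i l - b j l * c i k + b k l * c i j.

Definition Lambda2 : set 'M[R]_5 := [set b | b^T = - b].

Definition Lambda2_1 : set 'M[R]_5 := [set t *: Phi0 | t in [set: R]].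

Definition Lambda2_2 : set 'M[R]_5 :=
  Lambda2 `&` [set b | (forall i j k l, wedge22 Phi0 b i j k l = 0) /\
                       (forall i j k, hodge b i j k = wedge12 eta0 b i j k)].

Definition Lambda2_3 : set 'M[R]_5 :=
  Lambda2 `&` [set b | forall i j k, hodge b i j k = - wedge12 eta0 b i j k].

Definition Lambda2_4 : set 'M[R]_5 :=
  Lambda2 `&` [set b | forall i j k, wedge12 eta0 b i j k = 0].

Definition u2 : set 'M[R]_5 := set_sum Lambda2_1 Lambda2_3.
Definition u2perp : set 'M[R]_5 := set_sum Lambda2_2 Lambda2_4.

(* On Lambda2 = u2 (+) u2perp the set below is a singleton; the default
   value 0 is only taken outside Lambda2. *)
Definition pr_u2perp b : 'M[R]_5 :=
  xget 0 [set c | u2perp c /\ u2 (b - c)].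

Definition pr_W (T : tensor12) : tensor12 := fun k => pr_u2perp (T k).

Definition theta b : tensor12 := fun k => \matrix_(i, j) hodge b k i j.

Definition vartheta b : tensor12 :=
  fun k => \matrix_(i, j) (3 * eta0 k * b i j - hodge b k i j).

Definition W3 : set tensor12 := pr_W @` (theta @` Lambda2_1).
Definition W4 : set tensor12 := pr_W @` (theta @` Lambda2_2).
Definition W5 : set tensor12 := pr_W @` (theta @` Lambda2_3).
Definition W7 : set tensor12 := pr_W @` (vartheta @` Lambda2_2).

End TorsionModules.

Section IntrinsicTorsion.
Context {R : realType} {M : topologicalType} {A : smooth_manifold5 R M}.
Context {g : riemannian_metric A}.
Variable S : almost_contact_structure g.
Local Notation E := 'rV[R]_5.

Definition adapted_frame (i : chart_index A) (V : set E)
    (e : 'I_5 -> E -> E) : Prop :=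
  (forall a, smooth_on V (e a)) /\
  (forall x, V x -> forall a b,
     [/\ bilin (g i x) (e a x) (e b x) = (a == b)%:R,
         Phi (g i) (phi S i) x (e a x) (e b x) = Phi0 a b
       & eta (g i) (xi S i) x (e a x) = eta0 a]).

Definition connection_form (i : chart_index A) (e : 'I_5 -> E -> E)
    (X : E -> E) (x : E) : 'M[R]_5 :=
  \matrix_(a, b) bilin (g i x) (levi_civita (g i) X (e a) x) (e b x).

Definition intrinsic_torsion (i : chart_index A) (e : 'I_5 -> E -> E)
    (x : E) : 'I_5 -> 'M[R]_5 :=
  fun k => pr_u2perp (connection_form i e (e k) x).

Definition of_class (W : set ('I_5 -> 'M[R]_5)) : Prop :=
  forall i V e, coordinate_patch i V -> adapted_frame i V e ->
  forall x, V x -> W (intrinsic_torsion i e x).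

End IntrinsicTorsion.

(* Main.v *)
Require Import Defs.
From mathcomp Require Import all_boot all_order all_algebra.
From mathcomp Require Import all_classical all_reals all_analysis.
From mathcomp Require Import ring lra.

(* At a point x all conditions are tensorial: they are multilinear conditions on
   the covariant derivatives of phi and xi at x. In an adapted frame phi has the
   constant matrix - Phi0, so that nabla phi has the matrix [- Phi0, w], where w
   is the connection form of the frame, and nabla xi is the last row of w; both
   depend on the u(2)-perp part of w only. The theorem thereby reduces to linear
   algebra on the 30 components of this part, with the W_i as explicit spaces of
   matrices. As the class conditions quantify over adapted frames, the direction
   from the class to the structure also needs such frames around every point:
   these come from two Gram-Schmidt steps, f and h, completed to
   (f, - phi f, h, - phi h, xi). *)

Set Implicit Arguments.
Unset Strict Implicit.
Unset Printing Implicit Defensive.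
Import Order.TTheory GRing.Theory Num.Theory.
Import numFieldNormedType.Exports.

Local Open Scope classical_set_scope.
Local Open Scope ring_scope.

(** The answer follows a Kähler pattern. On the hyperplanes orthogonal to xi, N = 0 and d Phi = 0
    act as for an almost Hermitian structure that is both integrable and almost Kähler: they remove
    the Lambda^2_2-part of the torsion in horizontal directions. What remains is nabla xi, i.e. the
    numbers T_k(e_i, e_5), and the Lambda^2_2-part of T_5, which horizontal arguments never test.
    The Killing equation makes nabla xi skew and nabla_xi xi zero: 6 + 2 = 8 parameters, the
    dimension 1 + 2 + 3 + 2 of the four modules together. Arguments along xi add that T_5 vanishes
    and that the 2-form given by nabla xi has type (1,1): 4 = 1 + 3 parameters. Vectors are rows and
    endomorphisms act from the right, which fixes the signs: Phi(e_a, e_b) = g(e_a, phi e_b) gives P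
    phi = - Phi0 P for the matrix P whose rows are the frame. Tensoriality is not invoked
    abstractly: each condition is rewritten as an explicit expression in values at x, in which the
    derivatives of the test fields have cancelled. *)

Local Notation o0 := (@Ordinal 5 0 isT).
Local Notation o1 := (@Ordinal 5 1 isT).
Local Notation o2 := (@Ordinal 5 2 isT).
Local Notation o3 := (@Ordinal 5 3 isT).
Local Notation o4 := (@Ordinal 5 4 isT).

(** * Calculus of matrix-valued functions *)

Section MatrixCalculus.
Context {R : realType} {V : normedModType R}.
Implicit Types (x v : V).

Lemma differentiable_mxP m n (A : V -> 'M[R]_(m, n)) x :
  differentiable A x <-> forall i j, differentiable (fun y => A y i j) x.
Proof.
split=> [dA i j|dA].
  apply: (@differentiable_comp _ _ _ _ A (fun B : 'M[R]_(m, n) => B i j)) => //.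
  exact: differentiable_coord.
have -> : A = \sum_i \sum_j (fun y => A y i j *: delta_mx i j).
  apply/funext => y; rewrite fct_sumE {1}(matrix_sum_delta (A y)).
  by apply: eq_bigr => i _; rewrite fct_sumE.
apply: differentiable_sum => i; apply: differentiable_sum => j.
exact: differentiableZl.
Qed.

Lemma derive_entry m n (A : V -> 'M[R]_(m, n)) x v i j :
  differentiable A x -> ('D_v A x) i j = 'D_v (fun y => A y i j) x.
Proof. by move=> /diff_derivable dA; rewrite derive_mx ?mxE. Qed.

Lemma differentiable_mulmx m n p (A : V -> 'M[R]_(m, n)) (B : V -> 'M[R]_(n, p)) x :
  differentiable A x -> differentiable B x ->
  differentiable (fun y => A y *m B y) x.
Proof.
move=> /differentiable_mxP dA /differentiable_mxP dB.
apply/differentiable_mxP => i j.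
under eq_fun do rewrite mxE.
have -> : (fun y => \sum_k A y i k * B y k j) =
          \sum_k (fun y => A y i k * B y k j) :> (V -> R).
  by apply/funext => y; rewrite fct_sumE.
by apply: differentiable_sum => k; exact: differentiableM.
Qed.

Lemma derive_mulmx m n p (A : V -> 'M[R]_(m, n)) (B : V -> 'M[R]_(n, p)) x v :
  differentiable A x -> differentiable B x ->
  'D_v (fun y => A y *m B y) x = 'D_v A x *m B x + A x *m 'D_v B x.
Proof.
move=> dA dB; have dAB := differentiable_mulmx dA dB.
apply/matrixP => i j; rewrite derive_entry// !mxE -big_split/=.
under eq_fun do rewrite mxE.
have -> : (fun y => \sum_k A y i k * B y k j) =
          \sum_k (fun y => A y i k * B y k j) :> (V -> R).
  by apply/funext => y; rewrite fct_sumE.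
have dAe k : derivable (fun y => A y i k) x v.
  by apply: diff_derivable; move/differentiable_mxP: dA.
have dBe k : derivable (fun y => B y k j) x v.
  by apply: diff_derivable; move/differentiable_mxP: dB.
rewrite derive_sum => [|k]; last exact: derivableM.
apply: eq_bigr => k _; rewrite deriveM// !derive_entry//.
by rewrite addrC; congr (_ + _); rewrite /GRing.scale/= mulrC.
Qed.

Lemma differentiable_trmx m n (A : V -> 'M[R]_(m, n)) x :
  differentiable A x -> differentiable (fun y => (A y)^T) x.
Proof.
move=> /differentiable_mxP dA; apply/differentiable_mxP => i j.
by under eq_fun do rewrite mxE; exact: dA.
Qed.

Lemma derive_trmx m n (A : V -> 'M[R]_(m, n)) x v :
  differentiable A x -> 'D_v (fun y => (A y)^T) x = ('D_v A x)^T.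
Proof.
move=> dA; apply/matrixP => i j; rewrite mxE !derive_entry//.
  by under eq_fun do rewrite mxE.
exact: differentiable_trmx.
Qed.

Lemma derive_linear (W : normedModType R) (f : V -> W) x k u v :
  differentiable f x -> 'D_(k *: u + v) f x = k *: 'D_u f x + 'D_v f x.
Proof. by move=> df; rewrite !deriveE// linearP. Qed.

End MatrixCalculus.

(** * Smooth functions on open subsets of the model space *)

Section SmoothFunctions.
Context {R : realType}.
Local Notation E := 'rV[R]_5.
Implicit Types (U : set E).

Lemma open_near_eq (W : Type) U (f h : E -> W) x :
  open U -> U x -> (forall y, U y -> f y = h y) -> \near x, f x = h x.
Proof. by move=> oU Ux fh; apply: filterS (open_nbhs_nbhs (conj oU Ux)). Qed.

Lemma derive_eq_on (W : normedModType R) U (f h : E -> W) x v :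
  open U -> U x -> (forall y, U y -> f y = h y) -> 'D_v f x = 'D_v h x.
Proof. by move=> oU Ux fh; apply: near_eq_derive; exact: open_near_eq fh. Qed.

(** The first-order expansion of [f] at [x] holds for [h] as well, and uniqueness of the
    differential makes ['d f x] the differential of [h]. *)
Lemma differentiable_eq_on (W : normedModType R) U (f h : E -> W) x :
  open U -> U x -> (forall y, U y -> f y = h y) ->
  differentiable f x -> differentiable h x.
Proof.
move=> oU Ux fh /diff_locallyP[cf df].
have dh : h \o shift x = cst (h x) + 'd f x +o_ (0 : E) id.
  apply/eqaddoP => e e0; move/eqaddoP: df => /(_ e e0) df.
  have Ush : \forall y \near (0 : E), U (y + x).
    have : \forall z \near x, U z by exact: open_nbhs_nbhs.
    by rewrite (near_shift 0) subr0.
  by apply: filterS2 Ush df => y Uy; rewrite /= !fctE /= -!fh.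
by apply/diff_locallyP; rewrite (diff_unique cf dh).
Qed.

(** Rules such as the product rule identify a derivative only at points of [U]; this lemma lets the
    recursion in [Ck] pass from the derivative to the formula. *)
Lemma Ck_eq_on (W : normedModType R) k U (f h : E -> W) : open U ->
  (forall y, U y -> f y = h y) -> Ck k U f -> Ck k U h.
Proof.
move=> oU; elim: k f h => [|k IH] f h fh /=.
  move=> cf x Ux; have := cf x Ux; rewrite /prop_for /continuous_at fh//.
  by apply: cvg_trans; apply: (@near_eq_cvg _ _ (nbhs x) _ f h); exact: open_near_eq fh.
move=> [df Df]; split=> [x Ux|v]; first exact: differentiable_eq_on fh (df x Ux).
by apply: IH (Df v) => y Uy; exact: derive_eq_on fh.
Qed.

Lemma Ck_differentiable (W : normedModType R) k U (f : E -> W) x :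
  Ck k.+1 U f -> U x -> differentiable f x.
Proof. by case=> df _ Ux; exact: df. Qed.

Lemma CkW (W : normedModType R) k U (f : E -> W) : Ck k.+1 U f -> Ck k U f.
Proof.
elim: k f => [|k IH] f [df Df]; last by split=> // v; exact: IH.
by move=> x Ux; apply: differentiable_continuous; exact: df.
Qed.

Lemma Ck_subset (W : normedModType R) k U U' (f : E -> W) :
  U' `<=` U -> Ck k U f -> Ck k U' f.
Proof.
move=> UU'; elim: k f => [|k IH] f /=; first by move=> cf x /UU'; exact: cf.
by case=> df Df; split=> [x /UU'|v]; [exact: df|exact: IH].
Qed.

Lemma Ck_cst (W : normedModType R) k U (w : W) : Ck k U (fun=> w).
Proof.
elim: k w => [|k IH] w /=; first by move=> x _; exact: cst_continuous.
split=> [x _|v]; first exact: differentiable_cst.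
have -> : (fun x => 'D_v (fun=> w) x) = (fun=> 0 : W).
  by apply/funext => x; exact: derive_cst.
exact: IH.
Qed.

Lemma CkD (W : normedModType R) k U (f h : E -> W) : open U ->
  Ck k U f -> Ck k U h -> Ck k U (f + h).
Proof.
move=> oU; elim: k f h => [|k IH] f h /=.
  by move=> cf ch x Ux; apply: continuousD; [exact: cf|exact: ch].
move=> [df Df] [dh Dh]; split=> [x Ux|v].
  by apply: differentiableD; [exact: df|exact: dh].
apply: Ck_eq_on (IH _ _ (Df v) (Dh v)) => // y Uy.
by rewrite deriveD//; apply: diff_derivable; [exact: df|exact: dh].
Qed.

Lemma Ck_sum k U n (f : 'I_n -> E -> R) : open U ->
  (forall i, Ck k U (f i)) -> Ck k U (\sum_i f i).
Proof.
move=> oU; elim: n f => [|n IH] f Cf; first by rewrite big_ord0; exact: Ck_cst.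
by rewrite big_ord_recl; apply: CkD => //; apply: IH.
Qed.

Lemma CkM k U (f h : E -> R) : open U ->
  Ck k U f -> Ck k U h -> Ck k U (fun x => f x * h x).
Proof.
move=> oU; elim: k f h => [|k IH] f h.
  by move=> cf ch x Ux; apply: continuousM; [exact: cf|exact: ch].
(* The product rule pairs each function with a derivative of the other, so the induction also needs
   [f] and [h] themselves at the lower order. *)
move=> /[dup] /CkW Cf [df Df] /[dup] /CkW Ch [dh Dh]; split=> [x Ux|v].
  by apply: differentiableM; [exact: df|exact: dh].
apply: Ck_eq_on (CkD oU (IH _ _ Cf (Dh v)) (IH _ _ (Df v) Ch)) => // y Uy.
rewrite deriveM//; first by rewrite !fctE /GRing.scale/= [h y * _]mulrC.
  by apply: diff_derivable; exact: df.
by apply: diff_derivable; exact: dh.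
Qed.

(** The derivative is written as a product of ['D_v f] and copies of the function itself, so that
    [Ck_invsqrt] can proceed by induction with [CkM] alone. *)
Lemma is_derive_invsqrt (f : E -> R) x v : differentiable f x -> 0 < f x ->
  differentiable (fun y => (Num.sqrt (f y))^-1) x /\
  'D_v (fun y => (Num.sqrt (f y))^-1) x =
    - 2^-1 * 'D_v f x * ((Num.sqrt (f x))^-1 * (Num.sqrt (f x))^-1 * (Num.sqrt (f x))^-1).
Proof.
move=> df f0; have s0 : Num.sqrt (f x) != 0 by rewrite gt_eqF// sqrtr_gt0.
have [/derivable1_diffP ds Ds] := is_derive1_sqrt f0.
have dsf : differentiable (fun y => Num.sqrt (f y)) x.
  exact: (@differentiable_comp _ _ _ _ f (@Num.sqrt R)).
have Dsf : 'D_v (fun y => Num.sqrt (f y)) x = 'D_v f x * (2 * Num.sqrt (f x))^-1.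
  rewrite deriveE// (diff_comp df)//= -Ds !deriveE//.
  by rewrite -[X in 'd _ _ X = _]mulr1 [LHS]linearZ.
split; first exact: differentiableV.
rewrite deriveV//; last exact: diff_derivable.
by rewrite Dsf /GRing.scale/=; field.
Qed.

Lemma Ck_invsqrt k U (f : E -> R) : open U -> (forall x, U x -> 0 < f x) ->
  Ck k U f -> Ck k U (fun x => (Num.sqrt (f x))^-1).
Proof.
move=> oU f0; elim: k => [|k IH].
  move=> cf x Ux; apply: continuousV; first by rewrite gt_eqF// sqrtr_gt0 f0.
  by apply: continuous_comp; [exact: cf|exact: sqrt_continuous].
move=> /[dup] /CkW /IH Ch [df Df].
split=> [x Ux|v]; first by have [] := is_derive_invsqrt 0 (df x Ux) (f0 x Ux).
have CDf := CkM oU (Ck_cst k U (- 2^-1 : R)) (Df v).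
apply: Ck_eq_on (CkM oU CDf (CkM oU (CkM oU Ch Ch) Ch)) => //.
by move=> y Uy; have [_ ->] := is_derive_invsqrt v (df y Uy) (f0 y Uy).
Qed.

Lemma Ck_mxP k m n U (A : E -> 'M[R]_(m, n)) : open U ->
  Ck k U A <-> forall i j, Ck k U (fun x => A x i j).
Proof.
move=> oU; elim: k A => [|k IH] A.
  split=> [cA i j x Ux|cA x Ux].
    apply: (@continuous_comp _ _ _ A (fun B : 'M[R]_(m, n) => B i j)).
      exact: cA.
    exact: coord_continuous.
  have -> : A = \sum_i \sum_j (fun y => A y i j *: delta_mx i j).
    apply/funext => y; rewrite fct_sumE {1}(matrix_sum_delta (A y)).
    by apply: eq_bigr => i _; rewrite fct_sumE.
  apply: (big_ind (fun f : E -> 'M[R]_(m, n) => {for x, continuous f})).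
  - exact: cst_continuous.
  - by move=> f h; exact: continuousD.
  move=> i _; apply: (big_ind (fun f : E -> 'M[R]_(m, n) => {for x, continuous f})).
  - exact: cst_continuous.
  - by move=> f h; exact: continuousD.
  by move=> j _; apply: continuousZl; exact: cA.
split=> [[dA DA] i j|CA].
  split=> [x Ux|v]; first by move/differentiable_mxP: (dA x Ux); exact.
  move/IH: (DA v) => /(_ i j); apply: Ck_eq_on => // y Uy.
  by rewrite derive_entry//; exact: dA.
have dA x : U x -> differentiable A x.
  by move=> Ux; apply/differentiable_mxP => i j; apply: Ck_differentiable (CA i j) Ux.
split=> // v; apply/IH => i j; have [_ /(_ v)] := CA i j.
by apply: Ck_eq_on => // y Uy; rewrite derive_entry//; exact: dA.
Qed.

Lemma smooth_differentiable (W : normedModType R) U (f : E -> W) x :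
  smooth_on U f -> U x -> differentiable f x.
Proof. by move=> /(_ 1%N); exact: Ck_differentiable. Qed.

Lemma smooth_continuous (W : normedModType R) U (f : E -> W) x :
  smooth_on U f -> U x -> {for x, continuous f}.
Proof. by move=> /(_ 0%N) Cf Ux; exact: Cf. Qed.

Lemma smooth_subset (W : normedModType R) U U' (f : E -> W) :
  U' `<=` U -> smooth_on U f -> smooth_on U' f.
Proof. by move=> UU' sf k; exact: Ck_subset UU' (sf k). Qed.

Lemma smooth_eq_on (W : normedModType R) U (f h : E -> W) : open U ->
  (forall y, U y -> f y = h y) -> smooth_on U f -> smooth_on U h.
Proof. by move=> oU fh sf k; exact: Ck_eq_on fh (sf k). Qed.

Lemma smooth_cst (W : normedModType R) U (w : W) : smooth_on U (fun=> w).
Proof. by move=> k; exact: Ck_cst. Qed.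

Lemma smoothM U (f h : E -> R) : open U ->
  smooth_on U f -> smooth_on U h -> smooth_on U (fun x => f x * h x).
Proof. by move=> oU sf sh k; exact: CkM. Qed.

Lemma smooth_mxP m n U (A : E -> 'M[R]_(m, n)) : open U ->
  smooth_on U A <-> forall i j, smooth_on U (fun x => A x i j).
Proof.
move=> oU; split=> [sA i j k|sA k]; first by move/(Ck_mxP _ _ oU): (sA k).
by apply/(Ck_mxP _ _ oU) => i j; exact: sA.
Qed.

Lemma smoothD (W : normedModType R) U (f h : E -> W) : open U ->
  smooth_on U f -> smooth_on U h -> smooth_on U (fun x => f x + h x).
Proof. by move=> oU sf sh k; exact: CkD. Qed.

Lemma smooth_mulmx m n p U (A : E -> 'M[R]_(m, n)) (B : E -> 'M[R]_(n, p)) :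
  open U -> smooth_on U A -> smooth_on U B -> smooth_on U (fun x => A x *m B x).
Proof.
move=> oU /(smooth_mxP _ oU) sA /(smooth_mxP _ oU) sB.
apply/(smooth_mxP _ oU) => i j k; under eq_fun do rewrite mxE.
rewrite (_ : (fun x => _) = \sum_l (fun x => A x i l * B x l j)); last first.
  by apply/funext => y; rewrite fct_sumE.
by apply: Ck_sum => // l; exact: smoothM.
Qed.

Lemma smooth_scale m n U (f : E -> R) (A : E -> 'M[R]_(m, n)) : open U ->
  smooth_on U f -> smooth_on U A -> smooth_on U (fun x => f x *: A x).
Proof.
move=> oU sf /(smooth_mxP _ oU) sA; apply/(smooth_mxP _ oU) => i j.
by under eq_fun do rewrite mxE; exact: smoothM.
Qed.

Lemma smooth_trmx m n U (A : E -> 'M[R]_(m, n)) : open U ->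
  smooth_on U A -> smooth_on U (fun x => (A x)^T).
Proof.
move=> oU /(smooth_mxP _ oU) sA; apply/(smooth_mxP _ oU) => i j.
by under eq_fun do rewrite mxE; exact: sA.
Qed.

Lemma smooth_invsqrt U (f : E -> R) : open U -> (forall x, U x -> 0 < f x) ->
  smooth_on U f -> smooth_on U (fun x => (Num.sqrt (f x))^-1).
Proof. by move=> oU f0 sf k; exact: Ck_invsqrt. Qed.

End SmoothFunctions.

(** * The Hodge star in coordinates *)

(** The cases are closed terms with a fixed proof component, on which [nth] and equality tests
    compute. *)
Lemma forall_ord5 (P : 'I_5 -> Prop) :
  P o0 -> P o1 -> P o2 -> P o3 -> P o4 -> forall i, P i.
Proof.
move=> P0 P1 P2 P3 P4 [[|[|[|[|[|m]]]]] lt5] //;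
  by rewrite (bool_irrelevance lt5 isT).
Qed.

Lemma forall_ord4 (P : 'I_5 -> Prop) :
  P o0 -> P o1 -> P o2 -> P o3 -> forall i, i != o4 -> P i.
Proof. by move=> P0 P1 P2 P3; apply: forall_ord5. Qed.

Lemma sum_ord5 (V : zmodType) (F : 'I_5 -> V) :
  \sum_(i < 5) F i = F o0 + F o1 + F o2 + F o3 + F o4.
Proof.
rewrite !big_ord_recr big_ord0 /= add0r.
by do 4 ?[congr (_ + _)]; congr F; exact: val_inj.
Qed.

Lemma inord5E : ((inord 0 : 'I_5) = o0) * ((inord 1 : 'I_5) = o1) *
  ((inord 2 : 'I_5) = o2) * ((inord 3 : 'I_5) = o3) * ((inord 4 : 'I_5) = o4).
Proof. by do !split; apply: val_inj; rewrite /= inordK. Qed.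

Section HodgeStar.

(** Laplace expansion along the first row as a program on integers, so that the signs of the volume
    form can be evaluated by [vm_compute]. *)
Fixpoint det_fun (n : nat) (f : nat -> nat -> int) : int :=
  if n is n'.+1 then
    foldr (fun j s => f 0%N j * ((-1) ^+ j * det_fun n' (fun i k => f i.+1 (bump j k))) + s)
          0 (iota 0 n)
  else 1.

Lemma det_funE n (f : nat -> nat -> int) :
  \det (\matrix_(i < n, j < n) f i j) = det_fun n f.
Proof.
elim: n f => [|n IH] f; first by rewrite det_mx00.
have foldrE (F : nat -> int) r : foldr (fun j s => F j + s) 0 r = \sum_(j <- r) F j.
  by elim: r => [|j r IHr]; rewrite ?big_nil ?big_cons //= IHr.
rewrite (expand_det_row _ ord0) [RHS]foldrE.
rewrite -[iota 0 n.+1]/(index_iota 0 n.+1) big_mkord.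
apply: eq_bigr => j _; rewrite mxE /cofactor.
rewrite -/(det_fun n (fun i k => f i.+1 (bump j k))) -IH add0n; congr (_ * (_ * \det _)).
by apply/matrixP => i k; rewrite !mxE.
Qed.

Definition perm_sign (s : seq nat) : int :=
  det_fun 5 (fun a c => (nth 0%N s a == c)%:R).

Lemma volE (R : realType) i j k l m :
  vol i j k l m = (perm_sign [:: val i; val j; val k; val l; val m])%:~R :> R.
Proof.
rewrite /perm_sign -det_funE -det_map_mx; congr (\det _).
apply/matrixP => a c; rewrite !mxE rmorph_nat.
by move: a; apply: forall_ord5.
Qed.

(* The sign and the pair of indices (i, j) with *b(k, l, m) = +- b(i, j). *)
Definition hodge_index (k l m : nat) : int * nat * nat :=
  let c := [seq i <- iota 0 5 | i \notin [:: k; l; m]] in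
  let i := nth 0%N c 0 in let j := nth 0%N c 1 in
  (perm_sign [:: i; j; k; l; m], i, j).

(** At most two pairs (i, j) contribute to the Hodge star at (k, l, m): the complementary pair and
    its transposition. If k, l, m are not distinct, [hodge_index] still returns two indices, but its
    sign is 0, so no separate case arises. The check runs over all 5^5 tuples. *)
Lemma hodge_indexE :
  all (fun i => all (fun j => all (fun k => all (fun l => all (fun m =>
    let: (s, p, q) := hodge_index k l m in
    [&& (p < 5)%N, (q < 5)%N & perm_sign [:: i; j; k; l; m] ==
      s * ((i == p) && (j == q))%:R - s * ((i == q) && (j == p))%:R])
  (iota 0 5)) (iota 0 5)) (iota 0 5)) (iota 0 5)) (iota 0 5).
Proof. by vm_compute. Qed.

(** The double sum collapses to the terms of (p, q) and (q, p), which agree by skewness; this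
    cancels the factor 1/2. *)
Lemma hodgeE (R : realType) (b : 'M[R]_5) k l m : b^T = - b ->
  hodge b k l m = let: (s, p, q) := hodge_index k l m in
    s%:~R * b (inord p) (inord q).
Proof.
move=> skew; case E : (hodge_index k l m) => [[s p] q].
have ltI (i : 'I_5) : val i \in iota 0 5 by rewrite mem_iota ltn_ord.
have vol_pq i j : [/\ (p < 5)%N, (q < 5)%N & vol i j k l m = s%:~R *
    (((i == inord p) && (j == inord q))%:R - ((i == inord q) && (j == inord p))%:R) :> R].
  have /allP/(_ _ (ltI i))/allP/(_ _ (ltI j))/allP/(_ _ (ltI k)) := hodge_indexE.
  move=> /allP/(_ _ (ltI l))/allP/(_ _ (ltI m)); rewrite E => /and3P[p5 q5 /eqP vE].
  split=> //; rewrite volE vE -mulrBr rmorphM rmorphB !rmorph_nat.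
  by rewrite -!val_eqE /= !inordK.
rewrite /hodge.
have [p5 q5 _] := vol_pq o0 o0.
pose P : 'I_5 := inord p; pose Q : 'I_5 := inord q.
have -> : \sum_(i < 5) \sum_(j < 5) b i j * vol i j k l m = s%:~R * (b P Q - b Q P).
  rewrite mulrBr.
  have pick (c d : 'I_5) : \sum_(i < 5) \sum_(j < 5) b i j * ((i == c) && (j == d))%:R = b c d.
    rewrite (bigD1 c)//= (bigD1 d)//= !eqxx mulr1 !big1 ?addr0// => i /negPf ic.
      by rewrite big1// => j _; rewrite ic mulr0.
    by rewrite ic andbF mulr0.
  rewrite -(pick P Q) -(pick Q P) !mulr_sumr -sumrB; apply: eq_bigr => i _.
  rewrite !mulr_sumr -sumrB; apply: eq_bigr => j _.
  by have [_ _ ->] := vol_pq i j; ring.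
have -> : b Q P = - b P Q by have /matrixP/(_ P Q) := skew; rewrite !mxE.
by rewrite -/P -/Q; field.
Qed.

End HodgeStar.

(** * Two-forms as skew-symmetric matrices *)

Section SkewMatrices.
Context {R : realType}.

(** Coordinates on Lambda^2: the entries above the diagonal, row by row. Nested lists make every
    entry at closed indices computable. *)
Definition skew_mx (a01 a02 a03 a04 a12 a13 a14 a23 a24 a34 : R) : 'M[R]_5 :=
  \matrix_(i, j) nth 0 (nth [::]
    [:: [::     0;   a01;   a02;   a03; a04];
        [:: - a01;     0;   a12;   a13; a14];
        [:: - a02; - a12;     0;   a23; a24];
        [:: - a03; - a13; - a23;     0; a34];
        [:: - a04; - a14; - a24; - a34;   0]] i) j.

Lemma skew_mxE (a01 a02 a03 a04 a12 a13 a14 a23 a24 a34 : R) (i j : 'I_5) :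
  skew_mx a01 a02 a03 a04 a12 a13 a14 a23 a24 a34 i j = nth 0 (nth [::]
    [:: [::     0;   a01;   a02;   a03; a04];
        [:: - a01;     0;   a12;   a13; a14];
        [:: - a02; - a12;     0;   a23; a24];
        [:: - a03; - a13; - a23;     0; a34];
        [:: - a04; - a14; - a24; - a34;   0]] i) j.
Proof. by rewrite mxE. Qed.

Lemma skew_mx_of (b : 'M[R]_5) : b^T = - b ->
  b = skew_mx (b o0 o1) (b o0 o2) (b o0 o3) (b o0 o4) (b o1 o2) (b o1 o3)
              (b o1 o4) (b o2 o3) (b o2 o4) (b o3 o4).
Proof.
move=> skew; have bE i j : b i j = - b j i.
  by have /matrixP/(_ j i) := skew; rewrite !mxE.
have b0 i : b i i = 0 by have := bE i i; lra.
by apply/matrixP; apply: forall_ord5; apply: forall_ord5;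
  rewrite skew_mxE /= ?b0 // -bE.
Qed.

Lemma skew_mxT (a01 a02 a03 a04 a12 a13 a14 a23 a24 a34 : R) :
  let b := skew_mx a01 a02 a03 a04 a12 a13 a14 a23 a24 a34 in b^T = - b.
Proof.
by apply/matrixP; apply: forall_ord5; apply: forall_ord5;
  rewrite !mxE /= ?opprK ?oppr0.
Qed.

Lemma skew_mxP (b : 'M[R]_5) : b^T = - b -> exists a01 a02 a03 a04 a12 a13 a14 a23 a24 a34,
  b = skew_mx a01 a02 a03 a04 a12 a13 a14 a23 a24 a34.
Proof. by move=> /skew_mx_of ->; do 10 eexists. Qed.

Lemma theta_skew_mx (a01 a02 a03 a04 a12 a13 a14 a23 a24 a34 : R) :
  theta (skew_mx a01 a02 a03 a04 a12 a13 a14 a23 a24 a34) = fun k =>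
  nth 0 [:: skew_mx 0 0 0 0 a34 (- a24) a23 a14 (- a13) a12;
            skew_mx 0 (- a34) a24 (- a23) 0 0 0 (- a04) a03 (- a02);
            skew_mx a34 0 (- a14) a13 0 a04 (- a03) 0 0 a01;
            skew_mx (- a24) a14 0 (- a12) (- a04) 0 a02 0 (- a01) 0;
            skew_mx a23 (- a13) a12 0 a03 (- a02) 0 a01 0 0] k.
Proof.
apply/funext; apply: forall_ord5; apply/matrixP; apply: forall_ord5; apply: forall_ord5;
rewrite mxE hodgeE ?skew_mxT //;
(* The index pair and the sign are evaluated for the concrete triple, which leaves a single signed
   entry of the form. *)
match goal with |- context [hodge_index ?k ?l ?m] =>
  let v := eval vm_compute in (hodge_index k l m) in change (hodge_index k l m) with v end;
rewrite /= ?inord5E !skew_mxE /= ?mul0r ?mulN1r ?mul1r ?opprK ?oppr0 //.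
Qed.

End SkewMatrices.

(** * The modules W_i *)

Lemma hodge_skew_mx (R : realType) (a01 a02 a03 a04 a12 a13 a14 a23 a24 a34 : R) k l m :
  hodge (skew_mx a01 a02 a03 a04 a12 a13 a14 a23 a24 a34) k l m =
  nth (0 : 'M[R]_5) [:: skew_mx 0 0 0 0 a34 (- a24) a23 a14 (- a13) a12;
            skew_mx 0 (- a34) a24 (- a23) 0 0 0 (- a04) a03 (- a02);
            skew_mx a34 0 (- a14) a13 0 a04 (- a03) 0 0 a01;
            skew_mx (- a24) a14 0 (- a12) (- a04) 0 a02 0 (- a01) 0;
            skew_mx a23 (- a13) a12 0 a03 (- a02) 0 a01 0 0] k l m.
Proof.
transitivity (theta (skew_mx a01 a02 a03 a04 a12 a13 a14 a23 a24 a34) k l m).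
  by rewrite mxE.
by rewrite theta_skew_mx.
Qed.

Section Modules.
Context {R : realType}.
Local Notation M5 := 'M[R]_5.

Lemma Phi0E : Phi0 = skew_mx 1 0 0 0 0 0 0 1 0 0 :> M5.
Proof.
apply/matrixP; apply: forall_ord5; apply: forall_ord5;
rewrite !mxE !inord5E /=; ring.
Qed.

Lemma eta0E i : eta0 i = (i == o4)%:R :> R.
Proof. by rewrite /eta0 inord5E. Qed.

Lemma skew_mxD (a01 a02 a03 a04 a12 a13 a14 a23 a24 a34 : R)
    (b01 b02 b03 b04 b12 b13 b14 b23 b24 b34 : R) :
  skew_mx a01 a02 a03 a04 a12 a13 a14 a23 a24 a34 +
  skew_mx b01 b02 b03 b04 b12 b13 b14 b23 b24 b34 =
  skew_mx (a01 + b01) (a02 + b02) (a03 + b03) (a04 + b04) (a12 + b12)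
          (a13 + b13) (a14 + b14) (a23 + b23) (a24 + b24) (a34 + b34).
Proof.
by apply/matrixP; apply: forall_ord5; apply: forall_ord5;
  rewrite !mxE /= ?opprD ?addr0.
Qed.

Lemma skew_mxN (a01 a02 a03 a04 a12 a13 a14 a23 a24 a34 : R) :
  - skew_mx a01 a02 a03 a04 a12 a13 a14 a23 a24 a34 =
  skew_mx (- a01) (- a02) (- a03) (- a04) (- a12) (- a13) (- a14) (- a23) (- a24) (- a34).
Proof.
by apply/matrixP; apply: forall_ord5; apply: forall_ord5; rewrite !mxE /= ?oppr0.
Qed.

Lemma skew_mxZ t (a01 a02 a03 a04 a12 a13 a14 a23 a24 a34 : R) :
  t *: skew_mx a01 a02 a03 a04 a12 a13 a14 a23 a24 a34 =
  skew_mx (t * a01) (t * a02) (t * a03) (t * a04) (t * a12)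
          (t * a13) (t * a14) (t * a23) (t * a24) (t * a34).
Proof.
by apply/matrixP; apply: forall_ord5; apply: forall_ord5;
  rewrite !mxE /= ?mulrN ?mulr0.
Qed.

Lemma skew_mx_inj (a01 a02 a03 a04 a12 a13 a14 a23 a24 a34 : R)
    (b01 b02 b03 b04 b12 b13 b14 b23 b24 b34 : R) :
  skew_mx a01 a02 a03 a04 a12 a13 a14 a23 a24 a34 =
  skew_mx b01 b02 b03 b04 b12 b13 b14 b23 b24 b34 ->
  [/\ [/\ a01 = b01, a02 = b02, a03 = b03 & a04 = b04],
      [/\ a12 = b12, a13 = b13 & a14 = b14], a23 = b23, a24 = b24 & a34 = b34].
Proof.
move/matrixP => e.
have := (e o0 o1, e o0 o2, e o0 o3, e o0 o4, e o1 o2, e o1 o3, e o1 o4,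
         e o2 o3, e o2 o4, e o3 o4).
rewrite !skew_mxE /=.
by do 9![case]; do ![split].
Qed.

Lemma Lambda2_1P (b : M5) : Lambda2_1 b <-> exists t, b = skew_mx t 0 0 0 0 0 0 t 0 0.
Proof.
split=> [[t _ <-]|[t ->]]; exists t => //.
  by rewrite Phi0E skew_mxZ !mulr0 mulr1.
by rewrite Phi0E skew_mxZ !mulr0 mulr1.
Qed.

(* Both 2-forms have coefficients in Z[p, q], so that the identity is decided by
   computing with the integer coefficients. *)
Lemma Phi0_wedge_Lambda2_2 (p q : R) i j k l :
  wedge22 Phi0 (skew_mx 0 p q 0 q (- p) 0 0 0 0) i j k l = 0.
Proof.
pose entry (s : seq (seq int)) i j := nth 0 (nth [::] s i) j.
pose P := entry [:: [:: 0; 1; 0; 0; 0]; [:: -1; 0; 0; 0; 0]; [:: 0; 0; 0; 1; 0];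
                    [:: 0; 0; -1; 0; 0]; [::]].
pose B := entry [:: [:: 0; 0; 1; 0; 0]; [:: 0; 0; 0; -1; 0]; [:: -1; 0; 0; 0; 0];
                    [:: 0; 1; 0; 0; 0]; [::]].
pose C := entry [:: [:: 0; 0; 0; 1; 0]; [:: 0; 0; 1; 0; 0]; [:: 0; -1; 0; 0; 0];
                    [:: -1; 0; 0; 0; 0]; [::]].
pose w (b c : nat -> nat -> int) i j k l := b i j * c k l - b i k * c j l + b i l * c j k
  + b j k * c i l - b j l * c i k + b k l * c i j.
have w0 : all (fun i => all (fun j => all (fun k => all (fun l =>
    (w P B i j k l == 0) && (w P C i j k l == 0))
    (iota 0 5)) (iota 0 5)) (iota 0 5)) (iota 0 5) by vm_compute.
have ltI (m : 'I_5) : val m \in iota 0 5 by rewrite mem_iota ltn_ord.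
have /allP/(_ _ (ltI i))/allP/(_ _ (ltI j)) := w0.
move=> /allP/(_ _ (ltI k))/allP/(_ _ (ltI l))/andP[/eqP wB /eqP wC].
have PE : forall a c : 'I_5, Phi0 a c = (P a c)%:~R :> R.
  by apply: forall_ord5; apply: forall_ord5; rewrite Phi0E skew_mxE /= ?oppr0 ?mulrN1z.
have bE : forall a c : 'I_5, skew_mx 0 p q 0 q (- p) 0 0 0 0 a c =
    p * (B a c)%:~R + q * (C a c)%:~R.
  by apply: forall_ord5; apply: forall_ord5; rewrite skew_mxE /B /C /entry /=; ring.
have -> : wedge22 Phi0 (skew_mx 0 p q 0 q (- p) 0 0 0 0) i j k l =
    p * (w P B i j k l)%:~R + q * (w P C i j k l)%:~R.
  by rewrite /wedge22 !PE !bE /w; ring.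
by rewrite wB wC !mulr0 addr0.
Qed.

Lemma Lambda2_2P (b : M5) : Lambda2_2 b <-> exists p q, b = skew_mx 0 p q 0 q (- p) 0 0 0 0.
Proof.
split=> [[sb [wb hb]]|[p [q ->]]].
  have [a01[a02[a03[a04[a12[a13[a14[a23[a24[a34 bE]]]]]]]]]] := skew_mxP sb.
  exists a02, a03; rewrite bE in wb hb *.
  (* The component 0123 of the wedge product with Phi is b01 + b23. Together with b01 = b23, part of
     the self-duality condition, it makes both entries vanish. *)
  have := wb o0 o1 o2 o3; rewrite /wedge22 Phi0E !skew_mxE /= => w0123.
  have := (hb o0 o1 o2, hb o0 o1 o3, hb o0 o2 o3, hb o1 o2 o3,
           (hb o0 o1 o4, hb o0 o2 o4, hb o0 o3 o4)).
  rewrite !hodge_skew_mx /= !skew_mxE /wedge12 !eta0E !skew_mxE /=.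
  by case=> -[[[h1 h2] h3] h4] [[h5 h6] h7]; congr skew_mx; lra.
split; first exact: skew_mxT.
split; last first.
  apply: forall_ord5; apply: forall_ord5; apply: forall_ord5;
  rewrite hodge_skew_mx /= !skew_mxE /wedge12 !eta0E !skew_mxE /=; ring.
exact: Phi0_wedge_Lambda2_2.
Qed.

Lemma Lambda2_3P (b : M5) :
  Lambda2_3 b <-> exists s p q, b = skew_mx s p q 0 (- q) p 0 (- s) 0 0.
Proof.
split=> [[sb hb]|[s [p [q ->]]]].
  have [a01[a02[a03[a04[a12[a13[a14[a23[a24[a34 bE]]]]]]]]]] := skew_mxP sb.
  exists a01, a02, a03; rewrite bE in hb *.
  have := (hb o0 o1 o2, hb o0 o1 o3, hb o0 o2 o3, hb o1 o2 o3,
           (hb o0 o1 o4, hb o0 o2 o4, hb o0 o3 o4)).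
  rewrite !hodge_skew_mx /= !skew_mxE /wedge12 !eta0E !skew_mxE /=.
  by case=> -[[[h1 h2] h3] h4] [[h5 h6] h7]; congr skew_mx; lra.
split; first exact: skew_mxT.
apply: forall_ord5; apply: forall_ord5; apply: forall_ord5;
rewrite hodge_skew_mx /= !skew_mxE /wedge12 !eta0E !skew_mxE /=; ring.
Qed.

Lemma Lambda2_4P (b : M5) :
  Lambda2_4 b <-> exists r0 r1 r2 r3, b = skew_mx 0 0 0 r0 0 0 r1 0 r2 r3.
Proof.
split=> [[sb hb]|[r0 [r1 [r2 [r3 ->]]]]].
  have [a01[a02[a03[a04[a12[a13[a14[a23[a24[a34 bE]]]]]]]]]] := skew_mxP sb.
  exists a04, a14, a24, a34; rewrite bE in hb *.
  have := (hb o0 o1 o4, hb o0 o2 o4, hb o0 o3 o4, (hb o1 o2 o4, hb o1 o3 o4, hb o2 o3 o4)).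
  rewrite /wedge12 !eta0E !skew_mxE /=.
  by case=> -[[h1 h2] h3] [[h4 h5] h6]; congr skew_mx; lra.
split; first exact: skew_mxT.
apply: forall_ord5; apply: forall_ord5; apply: forall_ord5;
rewrite /wedge12 !eta0E !skew_mxE /=; ring.
Qed.

(** The entries a01, a23 lie in u(2) and those with index 4 in its complement. The pair (a02, a13)
    is (p, - p) on Lambda^2_2 and (p, p) on Lambda^2_3, and (a03, a12) is (q, q) and (q, - q)
    respectively, whence the half difference and the half sum. Existence and uniqueness of this
    splitting are proved here, so the default of [xget] is never met on skew matrices. *)
Lemma pr_u2perp_skew_mx (a01 a02 a03 a04 a12 a13 a14 a23 a24 a34 : R) :
  let p := (a02 - a13) / 2 in let q := (a03 + a12) / 2 in
  pr_u2perp (skew_mx a01 a02 a03 a04 a12 a13 a14 a23 a24 a34) =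
  skew_mx 0 p q a04 q (- p) a14 0 a24 a34.
Proof.
move=> p q; apply: xget_unique.
  split.
    exists (skew_mx 0 p q 0 q (- p) 0 0 0 0), (skew_mx 0 0 0 a04 0 0 a14 0 a24 a34); split.
    - by apply/Lambda2_2P; exists p, q.
    - by apply/Lambda2_4P; exists a04, a14, a24, a34.
    - by rewrite skew_mxD !addr0 !add0r.
  pose t := (a01 + a23) / 2.
  exists (skew_mx t 0 0 0 0 0 0 t 0 0).
  exists (skew_mx (a01 - t) (a02 - p) (a03 - q) 0 (- (a03 - q)) (a02 - p) 0 (- (a01 - t)) 0 0).
  split; first by apply/Lambda2_1P; exists t.
    by apply/Lambda2_3P; exists (a01 - t), (a02 - p), (a03 - q).
  by rewrite skew_mxN !skew_mxD; congr skew_mx; rewrite /t /p /q; field.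
move=> c [[c2 [c4 [/Lambda2_2P[p' [q' ->]] /Lambda2_4P[r0 [r1 [r2 [r3 ->]]]] ->]]]].
move=> [c1 [c3 [/Lambda2_1P[t ->] /Lambda2_3P[s [p'' [q'' ->]]]]]].
rewrite skew_mxD skew_mxN !skew_mxD => /skew_mx_inj.
move=> [[h1 h2 h3 h4] [h5 h6 h7] h8 h9 h10].
by congr skew_mx; rewrite /p /q; lra.
Qed.

(* The general element T of W_3 + W_4 + W_5 + W_7: the components T_k(e_i, e_5)
   with i, k <= 4 form a skew matrix, whose zero-based entries are the a_ki, and
   T_5 is the Lambda^2_2-form given by p and q. *)
Definition torsion_mx (a01 a02 a03 a12 a13 a23 p q : R) : 'I_5 -> M5 := fun k =>
  nth 0 [:: skew_mx 0 0 0 0 0 0 a01 0 a02 a03;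
            skew_mx 0 0 0 (- a01) 0 0 0 0 a12 a13;
            skew_mx 0 0 0 (- a02) 0 0 (- a12) 0 0 a23;
            skew_mx 0 0 0 (- a03) 0 0 (- a13) 0 (- a23) 0;
            skew_mx 0 p q 0 q (- p) 0 0 0 0] k.

Lemma torsion_mxD (a01 a02 a03 a12 a13 a23 p q b01 b02 b03 b12 b13 b23 p' q' : R) :
  torsion_mx a01 a02 a03 a12 a13 a23 p q + torsion_mx b01 b02 b03 b12 b13 b23 p' q' =
  torsion_mx (a01 + b01) (a02 + b02) (a03 + b03) (a12 + b12) (a13 + b13) (a23 + b23)
             (p + p') (q + q').
Proof.
by apply/funext; apply: forall_ord5; rewrite fctE /= skew_mxD; congr skew_mx; lra.
Qed.

Lemma W3P T : W3 T <-> exists t, T = torsion_mx t 0 0 0 0 t 0 0 :> ('I_5 -> M5).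
Proof.
have E t : pr_W (theta (skew_mx t 0 0 0 0 0 0 t 0 0)) = torsion_mx t 0 0 0 0 t 0 0.
  apply/funext; apply: forall_ord5; rewrite /pr_W theta_skew_mx /= pr_u2perp_skew_mx;
  by congr skew_mx; lra.
split=> [[_ [b /Lambda2_1P[t ->] <-] <-]|[t ->]]; first by exists t; rewrite E.
by rewrite -E; do 2 eexists => //; apply/Lambda2_1P; exists t.
Qed.

Lemma W4P T : W4 T <-> exists p q, T = torsion_mx 0 p q q (- p) 0 p q :> ('I_5 -> M5).
Proof.
have E p q : pr_W (theta (skew_mx 0 p q 0 q (- p) 0 0 0 0)) =
             torsion_mx 0 p q q (- p) 0 p q.
  apply/funext; apply: forall_ord5; rewrite /pr_W theta_skew_mx /= pr_u2perp_skew_mx;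
  by congr skew_mx; lra.
split=> [[_ [b /Lambda2_2P[p [q ->]] <-] <-]|[p [q ->]]]; first by exists p, q; rewrite E.
by rewrite -E; do 2 eexists => //; apply/Lambda2_2P; exists p, q.
Qed.

Lemma W5P T : W5 T <->
  exists s p q, T = torsion_mx (- s) (- p) (- q) q (- p) s 0 0 :> ('I_5 -> M5).
Proof.
have E s p q : pr_W (theta (skew_mx s p q 0 (- q) p 0 (- s) 0 0)) =
             torsion_mx (- s) (- p) (- q) q (- p) s 0 0.
  apply/funext; apply: forall_ord5; rewrite /pr_W theta_skew_mx /= pr_u2perp_skew_mx;
  by congr skew_mx; lra.
split=> [[_ [b /Lambda2_3P[s [p [q ->]]] <-] <-]|[s [p [q ->]]]].
  by exists s, p, q; rewrite E.
by rewrite -E; do 2 eexists => //; apply/Lambda2_3P; exists s, p, q.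
Qed.

Lemma vartheta_skew_mx (b : M5) k : vartheta b k = (3 * eta0 k) *: b - theta b k.
Proof. by apply/matrixP => i j; rewrite !mxE. Qed.

(** For b in Lambda^2_2 the Hodge star is eta wedge b, so [vartheta b] is 3 b - b = 2 b in the
    direction e_5 and [- theta b] in the others. The ratio of the two parts is 1 on W_4 and - 2 on
    W_7, so together they make both parts independent. *)
Lemma W7P T : W7 T <->
  exists p q, T = torsion_mx 0 (- p) (- q) (- q) p 0 (2 * p) (2 * q) :> ('I_5 -> M5).
Proof.
have E p q : pr_W (vartheta (skew_mx 0 p q 0 q (- p) 0 0 0 0)) =
             torsion_mx 0 (- p) (- q) (- q) p 0 (2 * p) (2 * q).
  apply/funext; apply: forall_ord5;
  rewrite /pr_W vartheta_skew_mx theta_skew_mx eta0E /=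
    skew_mxZ skew_mxN skew_mxD pr_u2perp_skew_mx;
  by congr skew_mx; lra.
split=> [[_ [b /Lambda2_2P[p [q ->]] <-] <-]|[p [q ->]]]; first by exists p, q; rewrite E.
by rewrite -E; do 2 eexists => //; apply/Lambda2_2P; exists p, q.
Qed.

(** The admissible forms a_ki are those of type (1,1): the line of Phi from W_3 and Lambda^2_3 from
    W_5. *)
Lemma W35P T : set_sum W3 W5 T <->
  exists a01 a02 a03 a23, T = torsion_mx a01 a02 a03 (- a03) a02 a23 0 0 :> ('I_5 -> M5).
Proof.
split=> [[_ [_ [/W3P[t ->] /W5P[s [p [q ->]]] ->]]]|[a01 [a02 [a03 [a23 ->]]]]].
  exists (t - s), (- p), (- q), (t + s); rewrite torsion_mxD; congr torsion_mx; lra.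
exists (torsion_mx ((a01 + a23) / 2) 0 0 0 0 ((a01 + a23) / 2) 0 0).
pose s := (a23 - a01) / 2.
exists (torsion_mx (- s) (- - a02) (- - a03) (- a03) (- - a02) s 0 0); split.
- by apply/W3P; eexists.
- by apply/W5P; exists s, (- a02), (- a03).
by rewrite torsion_mxD; congr torsion_mx; rewrite /s; lra.
Qed.

Lemma W3457P T : set_sum (set_sum (set_sum W3 W4) W5) W7 T <->
  exists a01 a02 a03 a12 a13 a23 p q,
    T = torsion_mx a01 a02 a03 a12 a13 a23 p q :> ('I_5 -> M5).
Proof.
split=> [[_ [_ [[_ [_ [[_ [_ [/W3P[t ->] /W4P[p1 [q1 ->]] ->]]]
    /W5P[s [p3 [q3 ->]]] ->]]] /W7P[p2 [q2 ->]] ->]]]|].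
  by rewrite !torsion_mxD; do 8 eexists.
move=> [a01 [a02 [a03 [a12 [a13 [a23 [p [q ->]]]]]]]].
(* The coordinates t and s separate a01 and a23; p3 and q3 are the Lambda^2_3-coordinates. The rest
   solves p1 - p2 = (a02 - a13) / 2 and p1 + 2 p2 = p, and likewise for q with (a03 + a12) / 2, so
   the denominator 3 is the determinant of this system. *)
pose t := (a01 + a23) / 2; pose s := (a23 - a01) / 2.
pose p3 := - (a02 + a13) / 2; pose p2 := (p - (a02 - a13) / 2) / 3; pose p1 := p - 2 * p2.
pose q3 := (a12 - a03) / 2; pose q2 := (q - (a03 + a12) / 2) / 3; pose q1 := q - 2 * q2.
exists (torsion_mx t 0 0 0 0 t 0 0 + torsion_mx 0 p1 q1 q1 (- p1) 0 p1 q1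
        + torsion_mx (- s) (- p3) (- q3) q3 (- p3) s 0 0).
exists (torsion_mx 0 (- p2) (- q2) (- q2) p2 0 (2 * p2) (2 * q2)); split.
- exists (torsion_mx t 0 0 0 0 t 0 0 + torsion_mx 0 p1 q1 q1 (- p1) 0 p1 q1).
  exists (torsion_mx (- s) (- p3) (- q3) q3 (- p3) s 0 0); split=> //.
    exists (torsion_mx t 0 0 0 0 t 0 0), (torsion_mx 0 p1 q1 q1 (- p1) 0 p1 q1).
    by split=> //; [apply/W3P; exists t|apply/W4P; exists p1, q1].
  by apply/W5P; exists s, p3, q3.
- by apply/W7P; exists p2, q2.
by rewrite !torsion_mxD; congr torsion_mx; rewrite /t /s /p1 /p2 /p3 /q1 /q2 /q3; field.
Qed.

End Modules.

(** * Components in an adapted frame *)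

Section FrameComponents.
Context {R : realType}.
Local Notation M5 := 'M[R]_5.
Implicit Types (w : 'I_5 -> M5) (k : 'I_5).

(* In an adapted frame, [e_a *m phi = phi_sign a *: e_(phi_ind a)]. *)
Definition phi_ind (a : 'I_5) : 'I_5 := nth o0 [:: o1; o0; o3; o2; o4] a.
Definition phi_sign (a : 'I_5) : R := nth 0 [:: -1; 1; -1; 1; 0] a.

Lemma mul_Phi0 (B : M5) a b : (- Phi0 *m B) a b = phi_sign a * B (phi_ind a) b.
Proof.
by rewrite mxE sum_ord5 Phi0E skew_mxN; move: a; apply: forall_ord5;
  rewrite !skew_mxE /phi_sign /phi_ind /=; ring.
Qed.

Lemma mulr_Phi0 (B : M5) a b : (B *m - Phi0) a b = - phi_sign b * B a (phi_ind b).
Proof.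
by rewrite mxE sum_ord5 Phi0E skew_mxN; move: b; apply: forall_ord5;
  rewrite !skew_mxE /phi_sign /phi_ind /=; ring.
Qed.

Definition nabla_phi_comp w k : M5 := - Phi0 *m w k - w k *m - Phi0.

(** [nabla_phi_comp w k c a] stands for g((nabla_(e_k) phi)(e_c), e_a). The last summand is eta(e_a)
    d eta(e_b, e_c), as nabla e_5 is the last row of [w]. *)
Definition nijenhuis_comp w (a b c : 'I_5) : R :=
  phi_sign b * nabla_phi_comp w (phi_ind b) c a
  - phi_sign c * nabla_phi_comp w (phi_ind c) b a
  - (nabla_phi_comp w b *m - Phi0) c a + (nabla_phi_comp w c *m - Phi0) b a
  + eta0 a * (w b o4 c - w c o4 b).

Definition d_Phi_comp w (a b c : 'I_5) : R :=
  nabla_phi_comp w a c b + nabla_phi_comp w b a c + nabla_phi_comp w c b a.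

Definition killing_comp w (a b : 'I_5) : R := w a o4 b + w b o4 a.

Lemma nabla_phi_compE w k a b : nabla_phi_comp w k a b =
  phi_sign a * w k (phi_ind a) b + phi_sign b * w k a (phi_ind b).
Proof.
by rewrite /nabla_phi_comp mxE [X in _ + X]mxE mul_Phi0 mulr_Phi0; ring.
Qed.

Lemma nijenhuis_compE w a b c : nijenhuis_comp w a b c =
  phi_sign b * nabla_phi_comp w (phi_ind b) c a
  - phi_sign c * nabla_phi_comp w (phi_ind c) b a
  + phi_sign a * nabla_phi_comp w b c (phi_ind a)
  - phi_sign a * nabla_phi_comp w c b (phi_ind a)
  + (a == o4)%:R * (w b o4 c - w c o4 b).
Proof. by rewrite /nijenhuis_comp !mulr_Phi0 eta0E; ring. Qed.

(** Skewness is built into the shape of [w], so that linear arithmetic meets only the independent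
    entries. *)
Lemma skew_family w : (forall k, (w k)^T = - w k) ->
  exists f : 'I_5 -> 'I_5 -> 'I_5 -> R, w = fun k =>
    skew_mx (f k o0 o1) (f k o0 o2) (f k o0 o3) (f k o0 o4) (f k o1 o2) (f k o1 o3)
            (f k o1 o4) (f k o2 o3) (f k o2 o4) (f k o3 o4).
Proof. by move=> sw; exists w; apply/funext => k; exact: skew_mx_of. Qed.

(** Prescribing the projection leaves the u(2)-part free; [u], [v] and [x], [y] are its coordinates,
    the former on the entries 01 and 23, the latter on the rest of Lambda^2_3. *)
Lemma torsion_mx_of w a01 a02 a03 a12 a13 a23 p q : (forall k, (w k)^T = - w k) ->
  (fun k => pr_u2perp (w k)) = torsion_mx a01 a02 a03 a12 a13 a23 p q ->
  exists u v x y : 'I_5 -> R, w = fun k =>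
    skew_mx (u k) (x k) (y k) 0 (- y k) (x k) 0 (v k) 0 0 +
    torsion_mx a01 a02 a03 a12 a13 a23 p q k.
Proof.
move=> sw; have [f ->] := skew_family sw => e.
exists (fun k => f k o0 o1), (fun k => f k o2 o3).
exists (fun k => (f k o0 o2 + f k o1 o3) / 2), (fun k => (f k o0 o3 - f k o1 o2) / 2).
apply/funext => k; rewrite -e pr_u2perp_skew_mx skew_mxD.
by congr skew_mx; lra.
Qed.

Definition componentsE := (nijenhuis_compE, nabla_phi_compE).

(** The counterpart of the fact that an integrable almost Kähler structure is Kähler: the
    Lambda^2_2-part of w_k vanishes for horizontal e_k. *)
Lemma torsion_of_components w : (forall k, (w k)^T = - w k) ->
  (forall a b c, a != o4 -> b != o4 -> c != o4 -> nijenhuis_comp w a b c = 0) ->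
  (forall a b c, a != o4 -> b != o4 -> c != o4 -> d_Phi_comp w a b c = 0) ->
  forall k, k != o4 -> w k o0 o2 = w k o1 o3 /\ w k o0 o3 = - w k o1 o2.
Proof.
move=> sw; have [f ->] := skew_family sw => HN HD.
(* One component of N and one of d Phi are two independent equations for the two unknowns of [p0]
   and [q1]; the same happens for [p1] and [q0], [p2] and [q3], [p3] and [q2]. *)
have p0 : f o0 o0 o2 = f o0 o1 o3.
  have := HN o0 o0 o2 isT isT isT; have := HD o0 o1 o2 isT isT isT.
  by rewrite /d_Phi_comp !componentsE /phi_ind /phi_sign /= !skew_mxE /=; clear -f; lra.
have p1 : f o1 o0 o2 = f o1 o1 o3.
  have := HN o0 o0 o3 isT isT isT; have := HD o0 o1 o3 isT isT isT.
  by rewrite /d_Phi_comp !componentsE /phi_ind /phi_sign /= !skew_mxE /=; clear -f; lra.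
have p2 : f o2 o0 o2 = f o2 o1 o3.
  have := HN o2 o0 o2 isT isT isT; have := HD o0 o2 o3 isT isT isT.
  by rewrite /d_Phi_comp !componentsE /phi_ind /phi_sign /= !skew_mxE /=; clear -f; lra.
have p3 : f o3 o0 o2 = f o3 o1 o3.
  have := HN o2 o0 o3 isT isT isT; have := HD o1 o2 o3 isT isT isT.
  by rewrite /d_Phi_comp !componentsE /phi_ind /phi_sign /= !skew_mxE /=; clear -f; lra.
have q0 : f o0 o0 o3 = - f o0 o1 o2.
  have := HN o0 o0 o3 isT isT isT; have := HD o0 o1 o3 isT isT isT.
  by rewrite /d_Phi_comp !componentsE /phi_ind /phi_sign /= !skew_mxE /=; clear -f; lra.
have q1 : f o1 o0 o3 = - f o1 o1 o2.
  have := HN o0 o0 o2 isT isT isT; have := HD o0 o1 o2 isT isT isT.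
  by rewrite /d_Phi_comp !componentsE /phi_ind /phi_sign /= !skew_mxE /=; clear -f; lra.
have q2 : f o2 o0 o3 = - f o2 o1 o2.
  have := HN o2 o0 o3 isT isT isT; have := HD o1 o2 o3 isT isT isT.
  by rewrite /d_Phi_comp !componentsE /phi_ind /phi_sign /= !skew_mxE /=; clear -f; lra.
have q3 : f o3 o0 o3 = - f o3 o1 o2.
  have := HN o2 o0 o2 isT isT isT; have := HD o0 o2 o3 isT isT isT.
  by rewrite /d_Phi_comp !componentsE /phi_ind /phi_sign /= !skew_mxE /=; clear -f; lra.
by apply: forall_ord4; rewrite !skew_mxE.
Qed.

(** Matrices in u(2) commute with [Phi0], so [u], [v], [x], [y] disappear. *)
Lemma nabla_phi_comp_torsion (u v x y : 'I_5 -> R) a01 a02 a03 a12 a13 a23 p q :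
  nabla_phi_comp (fun k => skew_mx (u k) (x k) (y k) 0 (- y k) (x k) 0 (v k) 0 0 +
                           torsion_mx a01 a02 a03 a12 a13 a23 p q k) = fun k =>
  nth 0 [:: skew_mx 0 0 0 (- a01) 0 0 0 0 (- a03) a02;
            skew_mx 0 0 0 0 0 0 (- a01) 0 (- a13) a12;
            skew_mx 0 0 0 a12 0 0 (- a02) 0 (- a23) 0;
            skew_mx 0 0 0 a13 0 0 (- a03) 0 0 (- a23);
            skew_mx 0 (- 2 * q) (2 * p) 0 (2 * p) (2 * q) 0 0 0 0] k.
Proof.
apply/funext; apply: forall_ord5; apply/matrixP; apply: forall_ord5; apply: forall_ord5;
by rewrite nabla_phi_compE /phi_ind /phi_sign /= skew_mxD !skew_mxE /=; ring.
Qed.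

(** Horizontal N and d Phi remove the Lambda^2_2-part of T_k for k <= 4, and the Killing equation
    makes T_k(e_i, e_5) skew in k and i. The Lambda^2_2-part of T_5 stays free and supplies p and
    q. *)
Lemma generalized_torsionP w : (forall k, (w k)^T = - w k) ->
  ((forall a b c, a != o4 -> b != o4 -> c != o4 ->
      nijenhuis_comp w a b c = 0 /\ d_Phi_comp w a b c = 0) /\
   (forall a b, killing_comp w a b = 0)) <->
  set_sum (set_sum (set_sum W3 W4) W5) W7 (fun k => pr_u2perp (w k)).
Proof.
move=> sw; rewrite W3457P; split=> [[H]|]; last first.
  move=> [a01 [a02 [a03 [a12 [a13 [a23 [p [q]]]]]]]].
  move=> /(torsion_mx_of sw)[u [v [x [y ->]]]]; split=> [a b c|].
    move: a b c; apply: forall_ord5; apply: forall_ord5; apply: forall_ord5 => // _ _ _;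
    by split; rewrite ?nijenhuis_compE ?/d_Phi_comp nabla_phi_comp_torsion
      /phi_ind /phi_sign /= ?skew_mxD !skew_mxE /=; ring.
  apply: forall_ord5; apply: forall_ord5;
  by rewrite /killing_comp /= !skew_mxD !skew_mxE /=; ring.
have := torsion_of_components sw.
have HN a b c a4 b4 c4 := proj1 (H a b c a4 b4 c4).
have HD a b c a4 b4 c4 := proj2 (H a b c a4 b4 c4).
move=> /(_ HN HD) {H HN HD}.
have [f ->] := skew_family sw => pq K.
(* As xi has unit length, w_k(e_5, e_5) = 0; the Killing equation on (xi, e_k) then reduces to
   nabla_xi xi = 0. *)
have r04 : f o4 o0 o4 = 0
  by have := K o4 o0; have := K o0 o4; rewrite /killing_comp !skew_mxE /=; clear -f; lra.
have r14 : f o4 o1 o4 = 0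
  by have := K o4 o1; have := K o1 o4; rewrite /killing_comp !skew_mxE /=; clear -f; lra.
have r24 : f o4 o2 o4 = 0
  by have := K o4 o2; have := K o2 o4; rewrite /killing_comp !skew_mxE /=; clear -f; lra.
have r34 : f o4 o3 o4 = 0
  by have := K o4 o3; have := K o3 o4; rewrite /killing_comp !skew_mxE /=; clear -f; lra.
have r00 : f o0 o0 o4 = 0
  by have := K o0 o0; rewrite /killing_comp !skew_mxE /=; clear -f; lra.
have r11 : f o1 o1 o4 = 0
  by have := K o1 o1; rewrite /killing_comp !skew_mxE /=; clear -f; lra.
have r22 : f o2 o2 o4 = 0
  by have := K o2 o2; rewrite /killing_comp !skew_mxE /=; clear -f; lra.
have r33 : f o3 o3 o4 = 0
  by have := K o3 o3; rewrite /killing_comp !skew_mxE /=; clear -f; lra.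
have r10 : f o1 o0 o4 = - f o0 o1 o4
  by have := K o1 o0; rewrite /killing_comp !skew_mxE /=; clear -f; lra.
have r20 : f o2 o0 o4 = - f o0 o2 o4
  by have := K o2 o0; rewrite /killing_comp !skew_mxE /=; clear -f; lra.
have r21 : f o2 o1 o4 = - f o1 o2 o4
  by have := K o2 o1; rewrite /killing_comp !skew_mxE /=; clear -f; lra.
have r30 : f o3 o0 o4 = - f o0 o3 o4
  by have := K o3 o0; rewrite /killing_comp !skew_mxE /=; clear -f; lra.
have r31 : f o3 o1 o4 = - f o1 o3 o4
  by have := K o3 o1; rewrite /killing_comp !skew_mxE /=; clear -f; lra.
have r32 : f o3 o2 o4 = - f o2 o3 o4
  by have := K o3 o2; rewrite /killing_comp !skew_mxE /=; clear -f; lra.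
exists (f o0 o1 o4), (f o0 o2 o4), (f o0 o3 o4), (f o1 o2 o4), (f o1 o3 o4), (f o2 o3 o4).
exists ((f o4 o0 o2 - f o4 o1 o3) / 2), ((f o4 o0 o3 + f o4 o1 o2) / 2).
apply/funext; apply: forall_ord5; rewrite pr_u2perp_skew_mx;
have := (pq o0 isT, pq o1 isT, pq o2 isT, pq o3 isT); rewrite !skew_mxE /=;
by move=> [[[[h1 h2] [h3 h4]] [h5 h6]] [h7 h8]];
  rewrite /= ?(h1, h2, h3, h4, h5, h6, h7, h8)
    ?(r00, r11, r22, r33, r10, r20, r30, r21, r31, r32, r04, r14, r24, r34);
  congr skew_mx; clear -f; field.
Qed.

(** The components with an argument along xi yield the Killing equations, and beyond them T_5 = 0
    ([p4], [q4]) and the invariance under phi of the form a_ki ([A], [B]). *)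
Lemma torsionP w : (forall k, (w k)^T = - w k) ->
  (forall a b c, nijenhuis_comp w a b c = 0 /\ d_Phi_comp w a b c = 0) <->
  set_sum W3 W5 (fun k => pr_u2perp (w k)).
Proof.
move=> sw; rewrite W35P; split=> [H|]; last first.
  move=> [a01 [a02 [a03 [a23]]]].
  move=> /(torsion_mx_of sw)[u [v [x [y ->]]]].
  apply: forall_ord5; apply: forall_ord5; apply: forall_ord5;
  by split; rewrite ?nijenhuis_compE ?/d_Phi_comp nabla_phi_comp_torsion
      /phi_ind /phi_sign /= ?skew_mxD !skew_mxE /=; ring.
have := torsion_of_components sw.
have HN a b c := proj1 (H a b c).
have HD a b c := proj2 (H a b c).
move=> /(_ (fun a b c _ _ _ => HN a b c) (fun a b c _ _ _ => HD a b c)) {H}.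
move: HN HD; have [f ->] := skew_family sw => HN HD pq.
(* The two components of d Phi add up to N(e_5, e_1, e_3) minus 4 p, where p is the
   Lambda^2_2-coordinate of T_5; [q4] is similar. *)
have p4 : f o4 o0 o2 = f o4 o1 o3.
  have := HD o0 o3 o4; have := HD o1 o2 o4; have := HN o4 o0 o2.
  by rewrite ?/d_Phi_comp !componentsE /phi_ind /phi_sign /= !skew_mxE /=; clear -f; lra.
have q4 : f o4 o0 o3 = - f o4 o1 o2.
  have := HD o0 o2 o4; have := HD o1 o3 o4; have := HN o4 o0 o3.
  by rewrite ?/d_Phi_comp !componentsE /phi_ind /phi_sign /= !skew_mxE /=; clear -f; lra.
have r04 : f o4 o0 o4 = 0.
  have := HN o4 o0 o4.
  by rewrite ?/d_Phi_comp !componentsE /phi_ind /phi_sign /= !skew_mxE /=; clear -f; lra.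
have r14 : f o4 o1 o4 = 0.
  have := HN o4 o1 o4.
  by rewrite ?/d_Phi_comp !componentsE /phi_ind /phi_sign /= !skew_mxE /=; clear -f; lra.
have r24 : f o4 o2 o4 = 0.
  have := HN o4 o2 o4.
  by rewrite ?/d_Phi_comp !componentsE /phi_ind /phi_sign /= !skew_mxE /=; clear -f; lra.
have r34 : f o4 o3 o4 = 0.
  have := HN o4 o3 o4.
  by rewrite ?/d_Phi_comp !componentsE /phi_ind /phi_sign /= !skew_mxE /=; clear -f; lra.
have r00 : f o0 o0 o4 = 0.
  have := HD o0 o1 o4; have := HN o0 o0 o4.
  by rewrite ?/d_Phi_comp !componentsE /phi_ind /phi_sign /= !skew_mxE /=; clear -f; lra.
have r11 : f o1 o1 o4 = 0.
  have := HD o0 o1 o4; have := HN o0 o0 o4.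
  by rewrite ?/d_Phi_comp !componentsE /phi_ind /phi_sign /= !skew_mxE /=; clear -f; lra.
have r22 : f o2 o2 o4 = 0.
  have := HD o2 o3 o4; have := HN o2 o2 o4.
  by rewrite ?/d_Phi_comp !componentsE /phi_ind /phi_sign /= !skew_mxE /=; clear -f; lra.
have r33 : f o3 o3 o4 = 0.
  have := HD o2 o3 o4; have := HN o2 o2 o4.
  by rewrite ?/d_Phi_comp !componentsE /phi_ind /phi_sign /= !skew_mxE /=; clear -f; lra.
have r10 : f o1 o0 o4 = - f o0 o1 o4.
  have := HN o0 o1 o4.
  by rewrite ?/d_Phi_comp !componentsE /phi_ind /phi_sign /= !skew_mxE /=; clear -f; lra.
have r20 : f o2 o0 o4 = - f o0 o2 o4.
  have := HD o0 o3 o4; have := HN o0 o2 o4.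
  by rewrite ?/d_Phi_comp !componentsE /phi_ind /phi_sign /= !skew_mxE /=; clear -f; lra.
have r21 : f o2 o1 o4 = - f o1 o2 o4.
  have := HD o0 o2 o4; have := HN o2 o1 o4.
  by rewrite ?/d_Phi_comp !componentsE /phi_ind /phi_sign /= !skew_mxE /=; clear -f; lra.
have r30 : f o3 o0 o4 = - f o0 o3 o4.
  have := HD o0 o2 o4; have := HN o0 o3 o4.
  by rewrite ?/d_Phi_comp !componentsE /phi_ind /phi_sign /= !skew_mxE /=; clear -f; lra.
have r31 : f o3 o1 o4 = - f o1 o3 o4.
  have := HD o0 o3 o4; have := HN o2 o0 o4.
  by rewrite ?/d_Phi_comp !componentsE /phi_ind /phi_sign /= !skew_mxE /=; clear -f; lra.
have r32 : f o3 o2 o4 = - f o2 o3 o4.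
  have := HN o2 o3 o4.
  by rewrite ?/d_Phi_comp !componentsE /phi_ind /phi_sign /= !skew_mxE /=; clear -f; lra.
have A : f o1 o3 o4 = f o0 o2 o4.
  have := HN o0 o2 o4; have := HN o2 o0 o4; have := HN o4 o0 o2.
  by rewrite ?/d_Phi_comp !componentsE /phi_ind /phi_sign /= !skew_mxE /=; clear -f; lra.
have B : f o1 o2 o4 = - f o0 o3 o4.
  have := HN o0 o3 o4; have := HN o2 o1 o4; have := HN o4 o0 o3.
  by rewrite ?/d_Phi_comp !componentsE /phi_ind /phi_sign /= !skew_mxE /=; clear -f; lra.
exists (f o0 o1 o4), (f o0 o2 o4), (f o0 o3 o4), (f o2 o3 o4).
apply/funext; apply: forall_ord5; rewrite pr_u2perp_skew_mx;
have := (pq o0 isT, pq o1 isT, pq o2 isT, pq o3 isT); rewrite !skew_mxE /=;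
by move=> [[[[h1 h2] [h3 h4]] [h5 h6]] [h7 h8]];
  rewrite /= ?(h1, h2, h3, h4, h5, h6, h7, h8)
    ?(r00, r11, r22, r33, r10, r20, r30, r21, r31, r32, r04, r14, r24, r34)
    ?A ?B ?p4 ?q4; congr skew_mx; clear -f; field.
Qed.

End FrameComponents.

(** * The Levi-Civita connection *)

Section Bilin.
Context {R : realType}.
Implicit Types (B : 'M[R]_5) (u v : 'rV[R]_5).

Lemma bilin_linearl B v k u u' :
  bilin B (k *: u + u') v = k * bilin B u v + bilin B u' v.
Proof. by rewrite /bilin !mulmxDl -!scalemxAl !mxE. Qed.

Lemma bilin_linearr B u k v v' :
  bilin B u (k *: v + v') = k * bilin B u v + bilin B u v'.
Proof. by rewrite /bilin linearP mulmxDr -scalemxAr !mxE. Qed.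

Lemma bilinDl B u u' v : bilin B (u + u') v = bilin B u v + bilin B u' v.
Proof. by rewrite /bilin !mulmxDl !mxE. Qed.

Lemma bilinNl B u v : bilin B (- u) v = - bilin B u v.
Proof. by rewrite /bilin !mulNmx !mxE. Qed.

Lemma bilinZl B k u v : bilin B (k *: u) v = k * bilin B u v.
Proof. by rewrite /bilin -!scalemxAl !mxE. Qed.

Lemma bilinDr B u v v' : bilin B u (v + v') = bilin B u v + bilin B u v'.
Proof. by rewrite /bilin linearD mulmxDr !mxE. Qed.

Lemma bilinNr B u v : bilin B u (- v) = - bilin B u v.
Proof. by rewrite /bilin linearN mulmxN !mxE. Qed.

Lemma bilinZr B k u v : bilin B u (k *: v) = k * bilin B u v.
Proof. by rewrite /bilin linearZ -scalemxAr !mxE. Qed.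

Lemma bilinC B u v : B^T = B -> bilin B u v = bilin B v u.
Proof.
move=> sB; rewrite /bilin -[in LHS](trmxK (u *m B *m v^T)) [LHS]mxE.
by rewrite !trmx_mul trmxK sB mulmxA.
Qed.

Lemma bilin_row B m n (C : 'M[R]_(m, 5)) (D : 'M[R]_(n, 5)) a b :
  bilin B (row a C) (row b D) = (C *m B *m D^T) a b.
Proof. by rewrite /bilin -row_mul !mxE; apply: eq_bigr => k _; rewrite !mxE. Qed.

Lemma posdef_unitmx B : (forall v, v != 0 -> 0 < bilin B v v) -> B \in unitmx.
Proof.
move=> B0; rewrite -row_free_unit -kermx_eq0; apply/rowV0P => v /sub_kermxP vB.
by apply/eqP/negPn/negP => /B0; rewrite /bilin vB mul0mx mxE ltxx.
Qed.

End Bilin.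

Section LeviCivita.
Context {R : realType}.
Local Notation E := 'rV[R]_5.
Variables (g : E -> 'M[R]_5) (x : E).
Implicit Types (v : E) (X Y Z : E -> E).

Definition connection v : 'M[R]_5 :=
  \matrix_(b, c) \sum_(a < 5) christoffel g x a b c * v 0 a.

(** The derivative acts on each row, so that m = 1 covers vector fields and m = 5 a whole frame. The
    direction is a vector at [x], not a field. *)
Definition nabla m v (Y : E -> 'M[R]_(m, 5)) : 'M[R]_(m, 5) :=
  'D_v Y x + Y x *m connection v.

Lemma levi_civitaE X Y : levi_civita g X Y x = nabla (X x) Y.
Proof.
rewrite /levi_civita /nabla; congr (_ + _); apply/rowP => c; rewrite !mxE.
rewrite exchange_big; apply: eq_bigr => b _; rewrite mxE mulr_sumr.
by apply: eq_bigr => a _; ring.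
Qed.

Lemma connection_linear k u v : connection (k *: u + v) = k *: connection u + connection v.
Proof.
apply/matrixP => b c; rewrite !mxE mulr_sumr -big_split /=.
by apply: eq_bigr => a _; rewrite !mxE; ring.
Qed.

Lemma nabla_linear m (Y : E -> 'M[R]_(m, 5)) k u v : differentiable Y x ->
  nabla (k *: u + v) Y = k *: nabla u Y + nabla v Y.
Proof.
move=> dY; rewrite /nabla derive_linear// connection_linear mulmxDr -scalemxAr.
by rewrite addrACA -scalerDr.
Qed.

Lemma nabla_mulmxl m n (A : 'M[R]_(m, n)) (Y : E -> 'M[R]_(n, 5)) v :
  differentiable Y x -> nabla v (fun y => A *m Y y) = A *m nabla v Y.
Proof.
move=> dY; rewrite /nabla (derive_mulmx (A := fun=> A))//.
by rewrite derive_cst mul0mx add0r mulmxDr mulmxA.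
Qed.

Lemma nabla_row m (Y : E -> 'M[R]_(m, 5)) v a :
  differentiable Y x -> nabla v (fun y => row a (Y y)) = row a (nabla v Y).
Proof. by move=> dY; under eq_fun do rewrite rowE; rewrite nabla_mulmxl// -rowE. Qed.

Lemma nabla_eq_on m U (Y Z : E -> 'M[R]_(m, 5)) v : open U -> U x ->
  (forall y, U y -> Y y = Z y) -> nabla v Y = nabla v Z.
Proof. by move=> oU Ux YZ; rewrite /nabla (derive_eq_on _ oU Ux YZ) YZ. Qed.

Hypothesis gdiff : differentiable g x.
Hypothesis gsym : (g x)^T = g x.
Hypothesis gunit : g x \in unitmx.
Hypothesis dgsym : forall v, ('D_v g x)^T = 'D_v g x.

Let dg (a b c : 'I_5) := 'D_(delta_mx 0 a) (fun y => g y b c) x.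

Let dgC a b c : dg a b c = dg a c b.
Proof. by rewrite /dg -!derive_entry// -{1}dgsym mxE. Qed.

Lemma christoffelC a b c : christoffel g x a b c = christoffel g x b a c.
Proof.
rewrite /christoffel; congr (_ * _); apply: eq_bigr => d _; congr (_ * _).
by rewrite -!/(dg _ _ _) (dgC d a b); ring.
Qed.

(** Absence of torsion in matrix form; it turns Lie brackets into covariant derivatives. *)
Lemma connectionC u v : u *m connection v = v *m connection u.
Proof.
apply/rowP => c; rewrite !mxE.
under eq_bigr => b _ do rewrite mxE mulr_sumr.
under [RHS]eq_bigr => b _ do rewrite mxE mulr_sumr.
rewrite exchange_big; apply: eq_bigr => a _; apply: eq_bigr => b _.
by rewrite christoffelC; ring.
Qed.

(** Lowering the upper index cancels the inverse metric and leaves the Christoffel symbols of the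
    first kind. *)
Lemma connection_mulg v :
  connection v *m g x =
    \matrix_(b, d) (2^-1 * \sum_a v 0 a * (dg a b d + dg b a d - dg d a b)).
Proof.
pose K : 'M[R]_5 := \matrix_(b, d) (2^-1 * \sum_a v 0 a * (dg a b d + dg b a d - dg d a b)).
have -> : connection v = K *m (invmx (g x))^T.
  apply/matrixP => b c; rewrite !mxE.
  under [RHS]eq_bigr => d _ do rewrite !mxE mulr_sumr mulr_suml.
  rewrite exchange_big; apply: eq_bigr => a _; rewrite /christoffel mulrAC mulr_sumr.
  by apply: eq_bigr => d _; rewrite -!/(dg _ _ _); ring.
by rewrite trmx_inv gsym -mulmxA mulVmx// mulmx1.
Qed.

(** In the sum of the first-kind symbols and their transposes, the two terms that are skew in b and
    d cancel. *)
Lemma metric_compatible v : 'D_v g x = connection v *m g x + g x *m (connection v)^T.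
Proof.
rewrite -{2}gsym -trmx_mul connection_mulg; apply/matrixP => b d; rewrite !mxE.
rewrite derive_entry// -mulrDr -big_split/=.
have -> : 'D_v (fun y => g y b d) x = \sum_a v 0 a * dg a b d.
  have dbd : differentiable (fun y => g y b d) x by move/differentiable_mxP: gdiff.
  rewrite deriveE// {1}(row_sum_delta v) linear_sum; apply: eq_bigr => a _.
  by rewrite linearZ -deriveE.
rewrite mulr_sumr; apply: eq_bigr => a _.
by rewrite (dgC a d b); field.
Qed.

Lemma derive_bilin_mx m n (A : E -> 'M[R]_(m, 5)) (B : E -> 'M[R]_(n, 5)) v :
  differentiable A x -> differentiable B x ->
  'D_v (fun y => A y *m g y *m (B y)^T) x =
    nabla v A *m g x *m (B x)^T + A x *m g x *m (nabla v B)^T.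
Proof.
move=> dA dB; have dAg := differentiable_mulmx dA gdiff.
rewrite derive_mulmx//; last exact: differentiable_trmx.
rewrite derive_mulmx// derive_trmx// metric_compatible /nabla.
rewrite [(_ + _)^T]linearD/= trmx_mul !mulmxDl !mulmxDr !mulmxDl !mulmxA.
by rewrite -!addrA; congr (_ + (_ + _)); rewrite addrC.
Qed.

Lemma derive_bilin (Y Z : E -> E) v : differentiable Y x -> differentiable Z x ->
  'D_v (fun y => bilin (g y) (Y y) (Z y)) x =
    bilin (g x) (nabla v Y) (Z x) + bilin (g x) (Y x) (nabla v Z).
Proof.
move=> dY dZ; rewrite /bilin -derive_entry; last first.
  by apply: differentiable_mulmx; [exact: differentiable_mulmx|exact: differentiable_trmx].
by rewrite derive_bilin_mx// mxE.
Qed.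

Lemma lie_bracketE X Y : lie_bracket X Y x = nabla (X x) Y - nabla (Y x) X.
Proof. by rewrite /lie_bracket /nabla connectionC opprD addrACA addrN addr0. Qed.

(** * Covariant derivatives of the almost contact structure *)

Section AlmostContact.
Variables (xi : E -> E) (phi : E -> 'M[R]_5).
Hypothesis xidiff : differentiable xi x.
Hypothesis phidiff : differentiable phi x.

(** The covariant derivative of the endomorphism phi; the Leibniz rule [nabla_mulphi] dictates the
    order and the signs for an action from the right. *)
Definition nabla_phi v : 'M[R]_5 :=
  'D_v phi x - connection v *m phi x + phi x *m connection v.

Lemma nabla_phi_linear k u v : nabla_phi (k *: u + v) = k *: nabla_phi u + nabla_phi v.
Proof.
rewrite /nabla_phi derive_linear// connection_linear mulmxDl mulmxDr -scalemxAl -scalemxAr.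
by rewrite opprD [X in X + _ = _]addrACA [LHS]addrACA !scalerDr scalerN.
Qed.

Lemma nabla_mulphi m (Y : E -> 'M[R]_(m, 5)) v : differentiable Y x ->
  nabla v (fun y => Y y *m phi y) = nabla v Y *m phi x + Y x *m nabla_phi v.
Proof.
move=> dY; rewrite /nabla /nabla_phi derive_mulmx// !mulmxDl !mulmxDr mulmxN !mulmxA.
by rewrite -!addrA; congr (_ + _); rewrite [RHS]addrCA addNKr.
Qed.

Definition nijenhuis_at (u v w : E) : R :=
  bilin (g x) u (w *m nabla_phi (v *m phi x) - v *m nabla_phi (w *m phi x)
                 - w *m nabla_phi v *m phi x + v *m nabla_phi w *m phi x)
  + eta g xi x u * (bilin (g x) (nabla v xi) w - bilin (g x) (nabla w xi) v).

(** Every bracket becomes a difference of covariant derivatives. By the Leibniz rule the derivatives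
    of [Y] and [Z] cancel and only those of phi survive, which is the tensoriality of [phi, phi]. *)
Lemma phi_bracketE Y Z : differentiable Y x -> differentiable Z x ->
  phi_bracket phi Y Z x =
    Z x *m nabla_phi (Y x *m phi x) - Y x *m nabla_phi (Z x *m phi x)
    - Z x *m nabla_phi (Y x) *m phi x + Y x *m nabla_phi (Z x) *m phi x.
Proof.
move=> dY dZ; rewrite /phi_bracket !lie_bracketE /app_phi !nabla_mulphi//.
move: (nabla (Y x *m phi x) Z) (nabla (Z x *m phi x) Y) => YZ ZY.
move: (nabla (Y x) Z) (nabla (Z x) Y) => cYZ cZY.
rewrite !(mulmxBl, mulmxDl).
move: (YZ *m phi x) (ZY *m phi x) (cYZ *m phi x *m phi x) (cZY *m phi x *m phi x) => a b c d.
move: (Z x *m nabla_phi (Y x *m phi x)) (Y x *m nabla_phi (Z x *m phi x)) => p q.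
move: (Z x *m nabla_phi (Y x) *m phi x) (Y x *m nabla_phi (Z x) *m phi x) => r s.
by apply/rowP => j; rewrite !mxE; ring.
Qed.

Lemma nabla_etaE Y Z : differentiable Z x ->
  nabla_eta g xi Y Z x = bilin (g x) (nabla (Y x) xi) (Z x).
Proof.
by move=> dZ; rewrite /nabla_eta /eta derive_bilin// levi_civitaE addrK.
Qed.

Lemma nijenhuisE X Y Z : differentiable Y x -> differentiable Z x ->
  nijenhuis g xi phi X Y Z x = nijenhuis_at (X x) (Y x) (Z x).
Proof.
by move=> dY dZ; rewrite /nijenhuis /nijenhuis_at phi_bracketE// /d_eta !nabla_etaE.
Qed.

Lemma nabla_PhiE X Y Z : differentiable Y x -> differentiable Z x ->
  nabla_Phi g phi X Y Z x = bilin (g x) (Y x) (Z x *m nabla_phi (X x)).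
Proof.
move=> dY dZ; rewrite /nabla_Phi /Phi derive_bilin//; last exact: differentiable_mulmx.
by rewrite nabla_mulphi// !levi_civitaE bilinDr; ring.
Qed.

Definition d_Phi_at (u v w : E) : R :=
  bilin (g x) v (w *m nabla_phi u) + bilin (g x) w (u *m nabla_phi v)
  + bilin (g x) u (v *m nabla_phi w).

Lemma d_PhiE X Y Z : differentiable X x -> differentiable Y x -> differentiable Z x ->
  d_Phi g phi X Y Z x = d_Phi_at (X x) (Y x) (Z x).
Proof. by move=> dX dY dZ; rewrite /d_Phi !nabla_PhiE. Qed.

Definition killing_at (u v : E) : R :=
  bilin (g x) (nabla u xi) v + bilin (g x) u (nabla v xi).

Lemma lie_derivative_metricE X Y : differentiable X x -> differentiable Y x ->
  lie_derivative_metric g xi X Y x = killing_at (X x) (Y x).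
Proof.
move=> dX dY; rewrite /killing_at /lie_derivative_metric derive_bilin// !lie_bracketE.
move: (nabla (xi x) X) (nabla (xi x) Y) (nabla (X x) xi) (nabla (Y x) xi) => a b c d.
by rewrite !(bilinDl, bilinDr, bilinNl, bilinNr); ring.
Qed.


Lemma nijenhuis_at_linear1 v w k u u' :
  nijenhuis_at (k *: u + u') v w = k * nijenhuis_at u v w + nijenhuis_at u' v w.
Proof. by rewrite /nijenhuis_at /eta bilin_linearl bilin_linearr; ring. Qed.

Lemma nijenhuis_at_linear2 u w k v v' :
  nijenhuis_at u (k *: v + v') w = k * nijenhuis_at u v w + nijenhuis_at u v' w.
Proof.
rewrite /nijenhuis_at nabla_linear// bilin_linearl bilin_linearr.
move: nabla_phi nabla_phi_linear => T Tlin; move: (@nabla 1) => D.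
rewrite !(mulmxDl, mulmxDr) -!scalemxAl !Tlin.
rewrite !(mulmxDl, mulmxDr) -!scalemxAr -!scalemxAl.
by rewrite !(bilinDr, bilinNr, bilinZr, opprD); ring.
Qed.

Lemma nijenhuis_at_linear3 u v k w w' :
  nijenhuis_at u v (k *: w + w') = k * nijenhuis_at u v w + nijenhuis_at u v w'.
Proof.
rewrite /nijenhuis_at nabla_linear// bilin_linearl bilin_linearr.
move: nabla_phi nabla_phi_linear => T Tlin; move: (@nabla 1) => D.
rewrite !(mulmxDl, mulmxDr) -!scalemxAl !Tlin.
rewrite !(mulmxDl, mulmxDr) -!scalemxAr -!scalemxAl.
by rewrite !(bilinDr, bilinNr, bilinZr, opprD); ring.
Qed.

Lemma d_Phi_at_cycle u v w : d_Phi_at u v w = d_Phi_at v w u.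
Proof. by rewrite /d_Phi_at; ring. Qed.

Lemma d_Phi_at_linear v w k u u' :
  d_Phi_at (k *: u + u') v w = k * d_Phi_at u v w + d_Phi_at u' v w.
Proof.
rewrite /d_Phi_at nabla_phi_linear; move: nabla_phi => T.
rewrite bilin_linearl !(mulmxDl, mulmxDr) -!scalemxAr -!scalemxAl.
by rewrite !(bilinDr, bilinZr); ring.
Qed.

Lemma killing_at_linear1 v k u u' :
  killing_at (k *: u + u') v = k * killing_at u v + killing_at u' v.
Proof. by rewrite /killing_at nabla_linear// !bilin_linearl; ring. Qed.

Lemma killing_atC u v : killing_at u v = killing_at v u.
Proof. by rewrite /killing_at addrC (bilinC u)// [X in _ + X]bilinC. Qed.

(** * Evaluation in an orthonormal adapted frame *)

Section Frame.
(** The rows of [P] are the frame vectors. The frame relations hold near [x], but only their values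
    and first derivatives at [x] enter; this is why they are assumed in pairs. *)
Variable P : E -> 'M[R]_5.
Hypothesis Pdiff : differentiable P x.
Hypothesis Porth : P x *m g x *m (P x)^T = 1%:M.
Hypothesis dPorth : forall v, 'D_v (fun y => P y *m g y *m (P y)^T) x = 0.
Hypothesis Pphi : P x *m phi x = - Phi0 *m P x.
Hypothesis nabla_Pphi : forall v,
  nabla v (fun y => P y *m phi y) = nabla v (fun y => - Phi0 *m P y).
Hypothesis Pxi : xi x = row o4 (P x).
Hypothesis nabla_Pxi : forall v, nabla v xi = nabla v (fun y => row o4 (P y)).

Definition frame_form v : 'M[R]_5 := nabla v P *m g x *m (P x)^T.

Let PgK : g x *m (P x)^T *m P x = 1%:M.
Proof. by apply: mulmx1C; rewrite mulmxA. Qed.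

Lemma nabla_frame v : nabla v P = frame_form v *m P x.
Proof. by rewrite /frame_form -[_ *m g x *m _]mulmxA -mulmxA PgK mulmx1. Qed.

Lemma frame_form_skew v : (frame_form v)^T = - frame_form v.
Proof.
apply/eqP; rewrite -addr_eq0 addrC /frame_form; apply/eqP.
have := dPorth v; rewrite derive_bilin_mx//.
by rewrite !trmx_mul trmxK gsym mulmxA.
Qed.

Let w k := frame_form (row k (P x)).

(** Differentiating P phi = - Phi0 P and inserting nabla P = W P gives P nabla phi = - Phi0 W P - W
    P phi, and P phi = - Phi0 P applies once more. *)
Lemma mul_nabla_phi k : P x *m nabla_phi (row k (P x)) = nabla_phi_comp w k *m P x.
Proof.
have := nabla_Pphi (row k (P x)); rewrite nabla_mulphi// nabla_mulmxl// nabla_frame.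
rewrite /nabla_phi_comp /w; move: (frame_form _) => W.
rewrite -mulmxA Pphi !mulmxA => /(canRL (addKr _)) ->.
by rewrite [LHS]addrC mulmxBl.
Qed.

Lemma bilin_frame (A B : 'M[R]_5) a b :
  bilin (g x) (row a (A *m P x)) (row b (B *m P x)) = (A *m B^T) a b.
Proof.
by rewrite bilin_row trmx_mul !mulmxA -(mulmxA A) -(mulmxA A) Porth mulmx1.
Qed.

Lemma bilin_framel (A : 'M[R]_5) a b : bilin (g x) (row a (A *m P x)) (row b (P x)) = A a b.
Proof. by rewrite -{2}(mul1mx (P x)) bilin_frame trmx1 mulmx1. Qed.

Lemma bilin_framer (A : 'M[R]_5) a b : bilin (g x) (row a (P x)) (row b (A *m P x)) = A b a.
Proof. by rewrite -{1}(mul1mx (P x)) bilin_frame mul1mx mxE. Qed.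

Lemma eta_frame a : eta g xi x (row a (P x)) = eta0 a.
Proof.
by rewrite /eta Pxi bilin_row Porth mxE eta0E eq_sym.
Qed.

Lemma row_mulphi a : row a (P x) *m phi x = phi_sign a *: row (phi_ind a) (P x).
Proof.
rewrite -row_mul Pphi; apply/rowP => j.
by rewrite !mxE -(mul_Phi0 (P x)) !mxE.
Qed.

Lemma nijenhuis_at_frame a b c :
  nijenhuis_at (row a (P x)) (row b (P x)) (row c (P x)) = nijenhuis_comp w a b c.
Proof.
have nphiZ k u : nabla_phi (k *: u) = k *: nabla_phi u.
  have T0 : nabla_phi 0 = 0.
    by have := nabla_phi_linear (-1) 0 0; rewrite scaler0 addr0 scaleN1r addNr.
  by have := nabla_phi_linear k u 0; rewrite !addr0 T0 addr0.
rewrite /nijenhuis_at !row_mulphi !nphiZ -!scalemxAr -!row_mul !mul_nabla_phi.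
rewrite /nijenhuis_comp; move: (nabla_phi_comp w) => T.
rewrite -!mulmxA Pphi !mulmxA !(bilinDr, bilinNr, bilinZr).
rewrite !bilin_framer eta_frame !nabla_Pxi !nabla_row// !nabla_frame.
by rewrite !bilin_framel.
Qed.

Lemma d_Phi_at_frame a b c :
  d_Phi_at (row a (P x)) (row b (P x)) (row c (P x)) = d_Phi_comp w a b c.
Proof.
rewrite /d_Phi_at -!row_mul !mul_nabla_phi.
by rewrite !bilin_framer.
Qed.

Lemma killing_at_frame a b :
  killing_at (row a (P x)) (row b (P x)) = killing_comp w a b.
Proof.
rewrite /killing_at !nabla_Pxi !nabla_row// !nabla_frame.
by rewrite bilin_framel bilin_framer.
Qed.

(** The coefficients of [u] in the orthonormal frame are its products with the frame vectors. The
    predicate [Q] serves both kinds of test fields: all indices for arbitrary vectors, those other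
    than [o4] for vectors orthogonal to xi. *)
Lemma frame_eq0 (f : E -> R) (Q : pred 'I_5) :
  (forall k u v, f (k *: u + v) = k * f u + f v) ->
  (forall a, Q a -> f (row a (P x)) = 0) ->
  forall u, (forall a, ~~ Q a -> bilin (g x) u (row a (P x)) = 0) -> f u = 0.
Proof.
move=> flin f0 u u0.
have f00 : f 0 = 0 by have := flin 1 0 0; rewrite scale1r addr0; lra.
have -> : u = \sum_a bilin (g x) u (row a (P x)) *: row a (P x).
  rewrite -[LHS]mulmx1 -PgK mulmxA mulmx_sum_row; apply: eq_bigr => a _.
  by congr (_ *: _); rewrite mulmxA /bilin !mxE; apply: eq_bigr => j _; rewrite !mxE.
have fsum (r : seq 'I_5) (F : 'I_5 -> E) : f (\sum_(a <- r) F a) = \sum_(a <- r) f (F a).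
  elim: r => [|a r IH]; rewrite ?big_nil// !big_cons -IH.
  by rewrite -[F a]scale1r flin scale1r mul1r.
rewrite fsum big1// => a _; rewrite -[_ *: _]addr0 flin f00 addr0.
by have [/f0 ->|/u0 ->] := boolP (Q a); rewrite ?mulr0 ?mul0r.
Qed.

End Frame.

End AlmostContact.
End LeviCivita.

(** * Existence of adapted frames *)

Section GramSchmidt.
Context {R : realType}.
Local Notation E := 'rV[R]_5.

Lemma open_pos (U : set E) (s : E -> R) : open U ->
  (forall y, U y -> {for y, continuous s}) -> open (U `&` [set y | 0 < s y]).
Proof.
move=> oU cs; rewrite openE => y [Uy sy].
by apply: filterI; [exact: open_nbhs_nbhs|exact: cvgr_gt (cs y Uy) _ sy].
Qed.

(** Otherwise A B is the identity of rank 5, although it factors through dimension n < 5. *)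
Lemma exists_not_fixed n (A : 'M[R]_(5, n)) (B : 'M[R]_(n, 5)) : (n < 5)%N ->
  exists u : E, u - u *m A *m B != 0.
Proof.
move=> n5; apply/not_existsP => fixed; move: n5; rewrite ltnNge => /negP; apply.
have AB : A *m B = 1%:M.
  apply/row_matrixP => i; rewrite !rowE mulmxA mulmx1; apply/esym/eqP.
  by rewrite -subr_eq0; apply/negPn/negP; exact: fixed.
by rewrite -[5%N](mxrank1 R) -AB (leq_trans (mxrankM_maxl _ _))// rank_leq_col.
Qed.

Lemma smooth_bilin (U : set E) (g : E -> 'M[R]_5) (X Y : E -> E) : open U ->
  smooth_on U g -> smooth_on U X -> smooth_on U Y ->
  smooth_on U (fun y => bilin (g y) (X y) (Y y)).
Proof.
move=> oU sg sX sY; rewrite /bilin.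
have : smooth_on U (fun y => X y *m g y *m (Y y)^T).
  by do 2?[apply: smooth_mulmx => //]; exact: smooth_trmx.
by move/(smooth_mxP _ oU)/(_ 0 0).
Qed.

(** A constant vector outside the span of the given fields at [x] is made orthogonal to them at each
    point; the result is nonzero at [x], hence on a neighbourhood, where it can be normalized. *)
Lemma gram_schmidt_step n (U : set E) (g : E -> 'M[R]_5) (q : 'I_n -> E -> E) x :
  (n < 5)%N -> open U -> U x -> smooth_on U g ->
  (forall y, U y -> forall v, v != 0 -> 0 < bilin (g y) v v) ->
  (forall a, smooth_on U (q a)) ->
  (forall y, U y -> forall a b, bilin (g y) (q a y) (q b y) = (a == b)%:R) ->
  exists V f, [/\ open V, V `<=` U, V x, smooth_on V f &
    forall y, V y -> bilin (g y) (f y) (f y) = 1 /\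
                     forall a, bilin (g y) (f y) (q a y) = 0].
Proof.
move=> n5 oU Ux sg g0 sq orth.
pose Q y : 'M[R]_(n, 5) := \matrix_a q a y.
have sQ : smooth_on U Q.
  apply/(smooth_mxP _ oU) => a j; under eq_fun do rewrite mxE.
  by move/(smooth_mxP _ oU): (sq a) => /(_ 0 j).
have QE y a : row a (Q y) = q a y by rewrite rowK.
have Qorth y : U y -> Q y *m g y *m (Q y)^T = 1%:M.
  by move=> Uy; apply/matrixP => a b; rewrite -bilin_row !QE orth// mxE.
have [u u0] := exists_not_fixed (g x *m (Q x)^T) (Q x) n5.
(* Since Q g Q^T = 1, right multiplication by g Q^T Q is the orthogonal projection onto the span of
   the rows of [Q]. *)
pose p y : E := u - u *m (g y *m (Q y)^T) *m Q y.
have sp : smooth_on U p.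
  apply: smoothD => //; first exact: smooth_cst.
  have : smooth_on U (fun y => (- u) *m (g y *m (Q y)^T) *m Q y).
    do 3?[apply: smooth_mulmx => //]; first exact: smooth_cst.
    exact: smooth_trmx.
  by apply: smooth_eq_on => // y _; rewrite !mulNmx.
have pq y a : U y -> bilin (g y) (p y) (q a y) = 0.
  move=> Uy; have -> : bilin (g y) (p y) (q a y) = (p y *m g y *m (Q y)^T) 0 a.
    by rewrite /bilin !mxE; apply: eq_bigr => j _; rewrite !mxE.
  rewrite /p !mulmxBl; set G := g y; set H := (Q y)^T.
  have -> : u *m (G *m H) *m Q y *m G *m H = u *m (G *m H) *m (Q y *m G *m H).
    by rewrite !mulmxA.
  by rewrite Qorth// mulmx1 mulmxA subrr mxE.
pose s y := bilin (g y) (p y) (p y).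
have ss : smooth_on U s by exact: smooth_bilin.
pose V := U `&` [set y | 0 < s y].
have oV : open V by apply: open_pos => // y Uy; exact: smooth_continuous ss Uy.
have VU : V `<=` U by move=> y [].
exists V, (fun y => (Num.sqrt (s y))^-1 *: p y); split=> //.
- by split=> //=; apply: g0 => //; rewrite /p mulmxA.
- apply: smooth_scale => //; last exact: smooth_subset VU sp.
  by apply: smooth_invsqrt => // [y []//|]; exact: smooth_subset VU ss.
move=> y [Uy sy]; split=> [|a]; last by rewrite bilinZl pq// mulr0.
have s0 : Num.sqrt (s y) != 0 by rewrite gt_eqF// sqrtr_gt0.
rewrite bilinZl bilinZr -/(s y) -[X in _ * (_ * X)](sqr_sqrtr (ltW sy)).
by field.
Qed.

End GramSchmidt.

(** * Adapted frames of the almost contact structure *)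

Section AdaptedFrames.
Context {R : realType} {M : topologicalType} {A : smooth_manifold5 R M}.
Context {g : riemannian_metric A} (S : almost_contact_structure g).
Local Notation E := 'rV[R]_5.
Variable i : chart_index A.
Local Notation G := (g i).
Local Notation xi := (xi S i).
Local Notation phi := (phi S i).

(** Evaluating phi^3 v with phi^2 applied last or first gives - phi v + eta(phi v) xi and - phi v,
    and xi is nonzero. *)
Lemma eta_mulphi x v : chart_img i x -> eta G xi x (v *m phi x) = 0.
Proof.
move=> Ux; have := phi_sqr S Ux (v *m phi x).
rewrite (phi_sqr S Ux v) mulmxDl mulNmx -scalemxAl phi_xi// scaler0 addr0.
move=> /esym/(canRL (addKr _)); rewrite addNr => /eqP.
rewrite scaler_eq0 => /orP[/eqP //|/eqP xi0].
by have := xi_unit S Ux; rewrite xi0 /bilin !mul0mx mxE => /esym/eqP; rewrite oner_eq0.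
Qed.

(** Compatibility of phi and g is applied to u and phi v; the terms with eta vanish by
    [eta_mulphi]. *)
Lemma mulphi_skew x u v : chart_img i x ->
  bilin (G x) (u *m phi x) v = - bilin (G x) u (v *m phi x).
Proof.
move=> Ux; have := phi_metric S Ux u (v *m phi x).
rewrite eta_mulphi// mulr0 subr0 phi_sqr// bilinDr bilinNr bilinZr.
have := eta_mulphi u Ux; rewrite /eta bilinC ?Defs.metric_sym// => ->.
by rewrite mulr0 addr0 => <-; rewrite opprK.
Qed.

Lemma exists_adapted_frame x : chart_img i x ->
  exists V e, [/\ coordinate_patch i V, V x & adapted_frame S i V e].
Proof.
move=> Ux; have oU : open (chart_img i) by exact: chart_img_open.
have g0 := @metric_posdef _ _ _ g i.
have sg := @metric_smooth _ _ _ g i.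
have gC y u v : chart_img i y -> bilin (G y) u v = bilin (G y) v u.
  by move=> Uy; rewrite bilinC// Defs.metric_sym.
have sxi : smooth_on (chart_img i) xi := @xi_smooth _ _ _ _ S i.
have sphi : smooth_on (chart_img i) phi := @phi_smooth _ _ _ _ S i.
have xi1 y : chart_img i y -> forall a b : 'I_1, bilin (G y) (xi y) (xi y) = (a == b)%:R.
  by move=> Uy a b; rewrite xi_unit// !ord1.
have [V1 [f [oV1 V1U V1x sf f1]]] :=
  gram_schmidt_step (isT : (1 < 5)%N) oU Ux sg g0 (fun _ : 'I_1 => sxi) xi1.
have etaE y u : eta G xi y u = bilin (G y) (xi y) u by [].
have etaM y u : chart_img i y -> bilin (G y) (xi y) (u *m phi y) = 0.
  by move=> Uy; rewrite -etaE eta_mulphi.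
have sf2 V (h : E -> E) : open V -> V `<=` chart_img i -> smooth_on V h ->
    smooth_on V (fun y => - h y *m phi y).
  move=> oV VU sh; have : smooth_on V (fun y => h y *m (- 1)%:M *m phi y).
    apply: smooth_mulmx => //; last exact: smooth_subset VU sphi.
    by apply: smooth_mulmx => //; exact: smooth_cst.
  by apply: smooth_eq_on => // y _; rewrite mul_mx_scalar scaleN1r.
have mulphi2 y u : chart_img i y -> bilin (G y) u (xi y) = 0 -> u *m phi y *m phi y = - u.
  by move=> Uy ux; rewrite phi_sqr// etaE gC// ux scale0r addr0.
have mulphiM y u v : chart_img i y -> bilin (G y) u (xi y) = 0 ->
    bilin (G y) (u *m phi y) (v *m phi y) = bilin (G y) u v.
  by move=> Uy ux; rewrite phi_metric// etaE (gC y (xi y) u)// ux mul0r subr0.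
have mulphi_self y u : chart_img i y -> bilin (G y) u (u *m phi y) = 0.
  by move=> Uy; have := mulphi_skew u u Uy; rewrite gC//; lra.
(* The second vector must avoid xi, f and phi f; the orthogonality of its own image under phi then
   follows from skewness and isometry of phi on the hyperplane orthogonal to xi. *)
pose q (a : 'I_3) := nth (fun=> 0) [:: xi; f; fun y => - f y *m phi y] a.
have sq a : smooth_on V1 (q a).
  case: a => [[|[|[|a]]]] // lta; rewrite /q /=.
  - exact: smooth_subset V1U sxi.
  - exact: sf2.
have orthq y : V1 y -> forall a b, bilin (G y) (q a y) (q b y) = (a == b)%:R.
  move=> V1y; have Uy := V1U y V1y; have [ff /(_ 0) fx] := f1 y V1y.
  have xf : bilin (G y) (xi y) (f y) = 0 by rewrite gC.
  move=> [[|[|[|a]]]] // lta [[|[|[|b]]]] // ltb; rewrite /q -val_eqE /= ?xi_unit//.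
  - by rewrite mulNmx bilinNr etaM// oppr0.
  - by rewrite mulNmx bilinNr mulphi_self// oppr0.
  - by rewrite mulNmx bilinNl gC// etaM// oppr0.
  - by rewrite mulNmx bilinNl gC// mulphi_self// oppr0.
  - by rewrite !mulNmx bilinNl bilinNr opprK mulphiM.
have V1g0 y : V1 y -> forall v, v != 0 -> 0 < bilin (G y) v v by move/V1U; exact: g0.
have [V [h [oV VV1 Vx sh h1]]] :=
  gram_schmidt_step (isT : (3 < 5)%N) oV1 V1x (smooth_subset V1U sg) V1g0 sq orthq.
have VU : V `<=` chart_img i by move=> y /VV1/V1U.
(* The sign in e_2 = - phi e_1 gives phi e_2 = e_1, hence Phi(e_1, e_2) = 1. *)
pose e (a : 'I_5) := nth (fun=> 0)
  [:: f; fun y => - f y *m phi y; h; fun y => - h y *m phi y; xi] a.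
exists V, e; split=> //; split.
  apply: forall_ord5; rewrite /e /=.
  - exact: smooth_subset VV1 sf.
  - by apply: sf2 => //; exact: smooth_subset VV1 sf.
  - exact: sh.
  - exact: sf2.
  - exact: smooth_subset VU sxi.
move=> y Vy; have Uy := VU y Vy; have [ff /(_ 0) fx] := f1 y (VV1 y Vy).
have [hh hq] := h1 y Vy; have hx : bilin (G y) (h y) (xi y) = 0 := hq 0.
have hf : bilin (G y) (h y) (f y) = 0 := hq (@Ordinal 3 1 isT).
have hf2 : bilin (G y) (h y) (- f y *m phi y) = 0 := hq (@Ordinal 3 2 isT).
have orth : forall a b, bilin (G y) (e a y) (e b y) = (a == b)%:R.
  have fx' : bilin (G y) (xi y) (f y) = 0 by rewrite gC.
  have hx' : bilin (G y) (xi y) (h y) = 0 by rewrite gC.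
  have f2h : bilin (G y) (f y) (h y) = 0 by rewrite gC.
  have hfp : bilin (G y) (h y) (f y *m phi y) = 0.
    by have := hf2; rewrite mulNmx bilinNr; lra.
  have fhp : bilin (G y) (f y) (h y *m phi y) = 0.
    by rewrite gC// mulphi_skew// hfp oppr0.
  apply: forall_ord5; apply: forall_ord5; rewrite /e /= ?mulNmx ?bilinNl ?bilinNr ?opprK
    ?mulphiM ?xi_unit ?ff ?hh ?hf ?f2h ?fx ?fx' ?hx ?hx' ?hfp ?fhp
    ?mulphi_self ?etaM ?oppr0 //;
  by rewrite gC// ?mulphi_self ?fhp ?hfp ?etaM ?oppr0.
have ephi b : e b y *m phi y = phi_sign b *: e (phi_ind b) y.
  move: b; apply: forall_ord5; rewrite /e /phi_sign /phi_ind /= ?mulNmx ?mulphi2 ?opprK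
    ?scaleN1r ?scale1r ?opprK ?phi_xi ?scale0r //.
move=> a b; split=> //.
- rewrite /Phi ephi bilinZr orth; move: a b; apply: forall_ord5; apply: forall_ord5;
  rewrite Phi0E skew_mxE /phi_sign /phi_ind /=; ring.
- by rewrite etaE -[xi y]/(e o4 y) orth eta0E eq_sym.
Qed.

End AdaptedFrames.

(** * The intrinsic torsion *)

Section PointwiseCharacterization.
Context {R : realType} {M : topologicalType} {A : smooth_manifold5 R M}.
Context {g : riemannian_metric A} (S : almost_contact_structure g).
Local Notation E := 'rV[R]_5.
Variable i : chart_index A.
Local Notation G := (g i).
Local Notation xi := (xi S i).
Local Notation phi := (phi S i).

Section Point.
Variable x : E.
Hypothesis Ux : chart_img i x.

Let oU : open (chart_img i). Proof. exact: chart_img_open. Qed.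

Lemma metric_differentiable : differentiable G x.
Proof. exact: smooth_differentiable (@metric_smooth _ _ _ g i) Ux. Qed.

Lemma xi_differentiable : differentiable xi x.
Proof. exact: smooth_differentiable (@xi_smooth _ _ _ _ S i) Ux. Qed.

Lemma phi_differentiable : differentiable phi x.
Proof. exact: smooth_differentiable (@phi_smooth _ _ _ _ S i) Ux. Qed.

Lemma metric_unitmx : G x \in unitmx.
Proof. by apply: posdef_unitmx => v; exact: metric_posdef. Qed.

Lemma derive_metric_sym v : ('D_v G x)^T = 'D_v G x.
Proof.
rewrite -derive_trmx; last exact: metric_differentiable.
by apply: (derive_eq_on v oU Ux) => y; exact: Defs.metric_sym.
Qed.

End Point.

Section Frame.
Variables (V : set E) (e : 'I_5 -> E -> E).
Hypothesis Vpatch : coordinate_patch i V.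
Hypothesis efr : adapted_frame S i V e.

Definition frame_mx y : 'M[R]_5 := \matrix_a e a y.

Let oV : open V. Proof. by case: Vpatch. Qed.
Let VU : V `<=` chart_img i. Proof. by case: Vpatch. Qed.

Lemma row_frame_mx a y : row a (frame_mx y) = e a y.
Proof. exact: rowK. Qed.

Lemma frame_mx_smooth : smooth_on V frame_mx.
Proof.
apply/(smooth_mxP _ oV) => a j; under eq_fun do rewrite mxE.
by move/(smooth_mxP _ oV): (efr.1 a) => /(_ 0 j).
Qed.

Lemma frame_mx_orth y : V y -> frame_mx y *m G y *m (frame_mx y)^T = 1%:M.
Proof.
move=> Vy; apply/matrixP => a b; rewrite -bilin_row !row_frame_mx mxE.
by have [] := efr.2 y Vy a b.
Qed.

Let frame_mxK y : V y -> G y *m (frame_mx y)^T *m frame_mx y = 1%:M.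
Proof. by move=> Vy; apply: mulmx1C; rewrite mulmxA frame_mx_orth. Qed.

(** The values of Phi on the frame form the matrix P g (P phi)^T; transposing turns [Phi0] into its
    negative. *)
Lemma frame_mx_phi y : V y -> frame_mx y *m phi y = - Phi0 *m frame_mx y.
Proof.
move=> Vy; have PE : frame_mx y *m G y *m (frame_mx y *m phi y)^T = Phi0.
  apply/matrixP => a b; rewrite -bilin_row row_mul !row_frame_mx.
  by have [] := efr.2 y Vy a b.
have Phi0T : - Phi0 = Phi0^T :> 'M[R]_5 by rewrite Phi0E skew_mxT.
rewrite Phi0T -PE !trmx_mul !trmxK Defs.metric_sym; last exact: VU.
by rewrite -!mulmxA [G y *m _]mulmxA frame_mxK// mulmx1.
Qed.

Lemma frame_mx_xi y : V y -> xi y = row o4 (frame_mx y).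
Proof.
move=> Vy; rewrite -[LHS]mulmx1 -(frame_mxK Vy) !mulmxA rowE; congr (_ *m _).
apply/rowP => a; have [_ _] := efr.2 y Vy a a; rewrite eta0E -row_frame_mx /eta /bilin.
by rewrite !mxE => <-; apply: eq_bigr => j _; rewrite !mxE.
Qed.

Variable x : E.
Hypothesis Vx : V x.

Definition connection_comp k : 'M[R]_5 := frame_form G x frame_mx (e k x).

Let dP : differentiable frame_mx x.
Proof. exact: smooth_differentiable frame_mx_smooth Vx. Qed.

Lemma intrinsic_torsionE :
  @intrinsic_torsion _ _ _ g i e x = fun k => pr_u2perp (connection_comp k).
Proof.
apply/funext => k; congr pr_u2perp; apply/matrixP => a b; rewrite mxE levi_civitaE.
rewrite /connection_comp /frame_form -bilin_row row_frame_mx -nabla_row//.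
by under [in RHS]eq_fun do rewrite row_frame_mx.
Qed.

Let Ux : chart_img i x := VU Vx.
Let dG := metric_differentiable Ux.
Let sG := @Defs.metric_sym _ _ _ g i x Ux.
Let uG := metric_unitmx Ux.
Let dsG := derive_metric_sym Ux.
Let dxi := xi_differentiable Ux.
Let dphi := phi_differentiable Ux.
Let Porth := frame_mx_orth Vx.
Let Pphi := frame_mx_phi Vx.
Let Pxi := frame_mx_xi Vx.

Let dPorth v : 'D_v (fun y => frame_mx y *m G y *m (frame_mx y)^T) x = 0.
Proof.
rewrite (derive_eq_on v oV Vx (h := fun=> 1%:M)) ?derive_cst// => y.
exact: frame_mx_orth.
Qed.

Let nabla_Pphi v : nabla G x v (fun y => frame_mx y *m phi y) =
                   nabla G x v (fun y => - Phi0 *m frame_mx y).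
Proof. exact: nabla_eq_on oV Vx frame_mx_phi. Qed.

Let nabla_Pxi v : nabla G x v xi = nabla G x v (fun y => row o4 (frame_mx y)).
Proof. exact: nabla_eq_on oV Vx frame_mx_xi. Qed.

Lemma connection_comp_skew k : (connection_comp k)^T = - connection_comp k.
Proof. exact: frame_form_skew. Qed.

Let wE : connection_comp = fun k => frame_form G x frame_mx (row k (frame_mx x)).
Proof. by apply/funext => k; rewrite row_frame_mx. Qed.

Lemma nijenhuis_at_comp a b c : nijenhuis_at G x xi phi (e a x) (e b x) (e c x) =
  nijenhuis_comp connection_comp a b c.
Proof. by rewrite wE -!row_frame_mx; exact: nijenhuis_at_frame. Qed.

Lemma d_Phi_at_comp a b c :
  d_Phi_at G x phi (e a x) (e b x) (e c x) = d_Phi_comp connection_comp a b c.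
Proof. by rewrite wE -!row_frame_mx; exact: d_Phi_at_frame. Qed.

Lemma killing_at_comp a b :
  killing_at G x xi (e a x) (e b x) = killing_comp connection_comp a b.
Proof. by rewrite wE -!row_frame_mx; exact: killing_at_frame. Qed.

Let linear_eq0 (f : E -> R) (Q : pred 'I_5) :
  (forall k u v, f (k *: u + v) = k * f u + f v) -> (forall a, Q a -> f (e a x) = 0) ->
  forall u, (forall a, ~~ Q a -> bilin (G x) u (e a x) = 0) -> f u = 0.
Proof.
move=> flin f0 u u0; apply: (frame_eq0 Porth flin (Q := Q))
  => a Qa;
by rewrite row_frame_mx ?f0 ?u0.
Qed.

Lemma nijenhuis_at_eq0 (Q : pred 'I_5) :
  (forall a b c, Q a -> Q b -> Q c -> nijenhuis_comp connection_comp a b c = 0) ->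
  forall u v w, (forall a, ~~ Q a ->
    [/\ bilin (G x) u (e a x) = 0, bilin (G x) v (e a x) = 0 & bilin (G x) w (e a x) = 0]) ->
  nijenhuis_at G x xi phi u v w = 0.
Proof.
move=> N0 u v w uvw.
apply: (linear_eq0 (f := fun u => nijenhuis_at G x xi phi u v w) (Q := Q))
  => [k u1 u2|a Qa|a /uvw[]//].
  exact: nijenhuis_at_linear1.
apply: (linear_eq0 (f := fun v => nijenhuis_at G x xi phi (e a x) v w) (Q := Q))
  => [k v1 v2|b Qb|b /uvw[]//].
  exact: nijenhuis_at_linear2.
apply: (linear_eq0 (f := nijenhuis_at G x xi phi (e a x) (e b x)) (Q := Q))
  => [k w1 w2|c Qc|c /uvw[]//].
  exact: nijenhuis_at_linear3.
by rewrite nijenhuis_at_comp N0.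
Qed.

Lemma d_Phi_at_eq0 (Q : pred 'I_5) :
  (forall a b c, Q a -> Q b -> Q c -> d_Phi_comp connection_comp a b c = 0) ->
  forall u v w, (forall a, ~~ Q a ->
    [/\ bilin (G x) u (e a x) = 0, bilin (G x) v (e a x) = 0 & bilin (G x) w (e a x) = 0]) ->
  d_Phi_at G x phi u v w = 0.
Proof.
move=> N0 u v w uvw.
have lin1 := d_Phi_at_linear G dphi.
have cyc := d_Phi_at_cycle G x phi.
apply: (linear_eq0 (f := fun u => d_Phi_at G x phi u v w) (Q := Q))
  => [k u1 u2|a Qa|a /uvw[]//].
  exact: lin1.
(* Cyclic symmetry brings each argument to the first slot, where linearity is known. *)
rewrite cyc; apply: (linear_eq0 (f := fun v => d_Phi_at G x phi v w (e a x)) (Q := Q))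
  => [k v1 v2|b Qb|b /uvw[]//].
  exact: lin1.
rewrite cyc; apply: (linear_eq0 (f := fun w => d_Phi_at G x phi w (e a x) (e b x)) (Q := Q))
  => [k w1 w2|c Qc|c /uvw[]//].
  exact: lin1.
by rewrite cyc d_Phi_at_comp N0.
Qed.

Lemma killing_at_eq0 : (forall a b, killing_comp connection_comp a b = 0) ->
  forall u v, killing_at G x xi u v = 0.
Proof.
move=> K0 u v; have lin1 := killing_at_linear1 G dxi.
apply: (linear_eq0 (f := fun u => killing_at G x xi u v) (Q := xpredT))
  => // a _.
rewrite killing_atC//.
apply: (linear_eq0 (f := fun v => killing_at G x xi v (e a x)) (Q := xpredT))
  => // b _.
by rewrite killing_at_comp K0.
Qed.

End Frame.
End PointwiseCharacterization.

(** * The two characterizations by torsion classes *)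

Theorem proposition3p1 (R : realType) (M : topologicalType)
    (A : smooth_manifold5 R M) (g : riemannian_metric A)
    (S : almost_contact_structure g) :
  (generalized_quasi_sasaki S <->
     of_class S (set_sum (set_sum (set_sum W3 W4) W5) W7)) /\
  (quasi_sasaki S <-> of_class S (set_sum W3 W5)).
Proof.
have sd V (X : 'rV[R]_5 -> 'rV[R]_5) x : smooth_on V X -> V x -> differentiable X x.
  by move=> sX Vx; exact: smooth_differentiable sX Vx.
have gqsP i V e x (Vp : coordinate_patch i V) (efr : adapted_frame S i V e) (Vx : V x) :=
  generalized_torsionP (connection_comp_skew Vp efr Vx).
have qsP i V e x (Vp : coordinate_patch i V) (efr : adapted_frame S i V e) (Vx : V x) :=
  torsionP (connection_comp_skew Vp efr Vx).
split; split.
(* The frame fields themselves serve as test fields: e_1, ..., e_4 are orthogonal to xi, and the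
   Killing equation is tested on all five. *)
- move=> [H K] i V e Vp efr x Vx; have Ux := Vp.2 x Vx.
  have dg := metric_differentiable Ux; have gs := @Defs.metric_sym _ _ _ g i x Ux.
  have gu := metric_unitmx Ux; have dgs := derive_metric_sym Ux.
  have dxi := xi_differentiable S Ux; have dphi := phi_differentiable S Ux.
  have de a : differentiable (e a) x by apply: sd (efr.1 a) Vx.
  rewrite (intrinsic_torsionE Vp efr Vx); apply/(gqsP _ _ _ _ Vp efr Vx).
  split=> [a b c a4 b4 c4|a b]; last first.
    have := K i V Vp _ _ (efr.1 a) (efr.1 b) x Vx.
    by rewrite lie_derivative_metricE// (killing_at_comp Vp efr Vx).
  have eperp d : d != o4 -> orthogonal_to_xi S i V (e d).
    move=> d4 y Vy; have [_ _] := efr.2 y Vy d d.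
    rewrite eta0E (negPf d4) /eta bilinC//.
    by apply: Defs.metric_sym; exact: Vp.2.
  have [] := H i V Vp _ _ _ (efr.1 a) (efr.1 b) (efr.1 c) (eperp a a4) (eperp b b4)
    (eperp c c4) x Vx.
  rewrite nijenhuisE// d_PhiE// (nijenhuis_at_comp Vp efr Vx).
  by rewrite (d_Phi_at_comp Vp efr Vx).
- move=> H; split=> [i V Vp X Y Z sX sY sZ X0 Y0 Z0 x Vx|i V Vp X Y sX sY x Vx].
    (* The patch [V'] of the frame is unrelated to [V]; this is harmless because both sides now
       depend on values at [x] only. *)
    have Ux := Vp.2 x Vx; have [V' [e [Vp' Vx' efr]]] := exists_adapted_frame S Ux.
    have dg := metric_differentiable Ux; have gs := @Defs.metric_sym _ _ _ g i x Ux.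
    have gu := metric_unitmx Ux; have dgs := derive_metric_sym Ux.
    have dxi := xi_differentiable S Ux; have dphi := phi_differentiable S Ux.
    have := H i V' e Vp' efr x Vx'; rewrite (intrinsic_torsionE Vp' efr Vx').
    move=> /(gqsP _ _ _ _ Vp' efr Vx')[ND _].
    (* The only frame vector outside [Q] is e_5 = xi, so the condition required of the test vectors
       is their orthogonality to xi. *)
    have xi4 a : ~~ (a != o4) -> e a x = xi S i x.
      by move=> /negPn/eqP ->; rewrite (frame_mx_xi efr)// row_frame_mx.
    rewrite nijenhuisE ?d_PhiE//; try by [exact: sd sX Vx|exact: sd sY Vx|exact: sd sZ Vx].
    split.
      apply: (nijenhuis_at_eq0 Vp' efr Vx' (Q := fun a => a != o4)) => [a b c a4 b4 c4|a a4].
        by have [] := ND a b c a4 b4 c4.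
      by rewrite xi4//; split; [exact: X0|exact: Y0|exact: Z0].
    apply: (d_Phi_at_eq0 Vp' efr Vx' (Q := fun a => a != o4)) => [a b c a4 b4 c4|a a4].
      by have [] := ND a b c a4 b4 c4.
    by rewrite xi4//; split; [exact: X0|exact: Y0|exact: Z0].
  have Ux := Vp.2 x Vx; have [V' [e [Vp' Vx' efr]]] := exists_adapted_frame S Ux.
  have dg := metric_differentiable Ux; have gs := @Defs.metric_sym _ _ _ g i x Ux.
  have gu := metric_unitmx Ux; have dgs := derive_metric_sym Ux.
  have dxi := xi_differentiable S Ux.
  have := H i V' e Vp' efr x Vx'; rewrite (intrinsic_torsionE Vp' efr Vx').
  move=> /(gqsP _ _ _ _ Vp' efr Vx')[_ K0].
  rewrite lie_derivative_metricE//; try by [exact: sd sX Vx|exact: sd sY Vx].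
  exact: (killing_at_eq0 Vp' efr Vx' K0).
- move=> H i V e Vp efr x Vx; have Ux := Vp.2 x Vx.
  have dg := metric_differentiable Ux; have gs := @Defs.metric_sym _ _ _ g i x Ux.
  have gu := metric_unitmx Ux; have dgs := derive_metric_sym Ux.
  have dxi := xi_differentiable S Ux; have dphi := phi_differentiable S Ux.
  have de a : differentiable (e a) x by apply: sd (efr.1 a) Vx.
  rewrite (intrinsic_torsionE Vp efr Vx); apply/(qsP _ _ _ _ Vp efr Vx) => a b c.
  have [] := H i V Vp _ _ _ (efr.1 a) (efr.1 b) (efr.1 c) x Vx.
  rewrite nijenhuisE// d_PhiE// (nijenhuis_at_comp Vp efr Vx).
  by rewrite (d_Phi_at_comp Vp efr Vx).
move=> H i V Vp X Y Z sX sY sZ x Vx.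
have Ux := Vp.2 x Vx; have [V' [e [Vp' Vx' efr]]] := exists_adapted_frame S Ux.
have dg := metric_differentiable Ux; have gs := @Defs.metric_sym _ _ _ g i x Ux.
have gu := metric_unitmx Ux; have dgs := derive_metric_sym Ux.
have dxi := xi_differentiable S Ux; have dphi := phi_differentiable S Ux.
have := H i V' e Vp' efr x Vx'; rewrite (intrinsic_torsionE Vp' efr Vx').
move=> /(qsP _ _ _ _ Vp' efr Vx') ND.
rewrite nijenhuisE ?d_PhiE//; try by [exact: sd sX Vx|exact: sd sY Vx|exact: sd sZ Vx].
split.
  apply: (nijenhuis_at_eq0 Vp' efr Vx' (Q := xpredT))
  => // a b c _ _ _.
  by have [] := ND a b c.
apply: (d_Phi_at_eq0 Vp' efr Vx' (Q := xpredT))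
  => // a b c _ _ _.
by have [] := ND a b c.
Qed.
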